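(* Let $H$ be an ordered graph, $x\in(0,1)$, and define $f(x,H):=1-\frac{1}{\chi^*_{cr}(x,H)}$. Given any $\eta>0$, there exists $n_0=n_0(x,H,\eta)\in\mathbb N$ such that if $G$ is an ordered graph on $n\geq n_0$ vertices with $\delta(G)\geq (f(x,H)+\eta)n$, then $G$ contains an $(x,H)$-tiling.
   Context: An ordered graph on $h$ vertices is a graph with vertex set $[h]$ (ordered naturally). An ordered graph $G$ on $[n]$ contains an ordered graph $H$ on $[h]$ if there is an injection $\phi:[h]\to[n]$ with $\phi(i)<\phi(j)$ for $i<j$ and $\phi(i)\phi(j)\in E(G)$ whenever $ij\in E(H)$; the image is a copy of $H$. An $H$-tiling is a collection of vertex-disjoint copies of $H$; an $(x,H)$-tiling in $G$ is an $H$-tiling covering at least $x|G|$ vertices. For sets of integers, $X<Y$ means $a<b$ for all $a\in X,b\in Y$. For a complete $k$-partite unordered graph $B$ with parts $U_1,\dots,U_k$ and a permutation $\sigma$ of $[k]$, an interval labelling of $B$ with respect to $\sigma$ is a bijection $\phi:V(B)\to[|B|]$ with $\phi(U_i)<\phi(U_j)$ whenever $\sigma(i)<\sigma(j)$; this yields an ordered graph. For $x\in(0,1]$, an unordered graph $B$ is an $x$-bottlegraph of $H$ if (i) $B$ is complete $k$-partite with parts $U_1,\dots,U_k$ for some $k$; (ii) there is $m\in\mathbb N$ with $|U_1|\le m$ and $|U_i|=m$ for all $i>1$; (iii) for every permutation $\sigma$ of $[k]$ and every interval labelling of $B$ with respect to $\sigma$, the resulting ordered graph contains an $(x,H)$-tiling.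 For an unordered graph $F$, $\chi_{cr}(F)=(\chi(F)-1)\frac{|F|}{|F|-\sigma(F)}$, where $\sigma(F)$ is the smallest possible size of a colour class over all proper $\chi(F)$-colourings of $F$. $\chi^*_{cr}(x,H):=\inf\{\chi_{cr}(B): B \text{ an } x\text{-bottlegraph of } H\}$. *)

(* Defs.v *)
From mathcomp Require Import all_boot all_order all_algebra perm.
From mathcomp Require Import classical_sets reals.

Set Implicit Arguments.
Unset Strict Implicit.
Unset Printing Implicit Defensive.

Import Order.TTheory GRing.Theory Num.Theory.

Record sgraph (T : finType) := SGraph {
  adj :> rel T;
  adj_sym : symmetric adj;
  adj_irr : irreflexive adj
}.

Notation ordered_graph n := (sgraph 'I_n).

Definition degree (T : finType) (G : sgraph T) (v : T) : nat :=
  #|[set w | G v w]|.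

(* Every degree is at most #|T|, so the unit of the iterated minimum only
   matters for the graph without vertices. *)
Definition min_degree (T : finType) (G : sgraph T) : nat :=
  \big[minn/#|T|]_(v : T) degree G v.

(* A strictly increasing map is injective. *)
Definition embedding h n (H : ordered_graph h) (G : ordered_graph n)
    (phi : {ffun 'I_h -> 'I_n}) : bool :=
  [forall i : 'I_h, forall j : 'I_h, (i < j) ==> (phi i < phi j)] &&
  [forall i, forall j, H i j ==> G (phi i) (phi j)].

(* A copy of H is recorded by its vertex set: an increasing map is determined
   by its image, so the vertex set determines the copy. *)
Definition is_copy h n (H : ordered_graph h) (G : ordered_graph n)
    (A : {set 'I_n}) : bool :=
  [exists phi : {ffun 'I_h -> 'I_n},
     embedding H G phi && (A == [set phi i | i in 'I_h])].

Definition is_tiling h n (H : ordered_graph h) (G : ordered_graph n)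
    (P : {set {set 'I_n}}) : bool :=
  finset.trivIset P && [forall A in P, is_copy H G A].

Definition has_tiling (R : realType) (x : R) h n
    (H : ordered_graph h) (G : ordered_graph n) : Prop :=
  exists2 P : {set {set 'I_n}},
    is_tiling H G P & (x * n%:R <= #|finset.cover P|%:R)%R.

Definition proper_coloring (T : finType) (F : sgraph T) k
    (c : {ffun T -> 'I_k}) : bool :=
  [forall u, forall v, F u v ==> (c u != c v)].

Definition colorable (T : finType) (F : sgraph T) (k : nat) : bool :=
  [exists c : {ffun T -> 'I_k}, proper_coloring F c].

Lemma colorable_ex (T : finType) (F : sgraph T) : exists k, colorable F k.
Proof.
exists #|T|; apply/existsP; exists [ffun v => enum_rank v].
apply/forallP => u; apply/forallP => v; apply/implyP => Fuv.
rewrite !ffunE (inj_eq enum_rank_inj); apply: contraTneq Fuv => ->.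
by rewrite adj_irr.
Qed.

Definition chi (T : finType) (F : sgraph T) : nat := ex_minn (colorable_ex F).

(* The parameter written sigma(F); classes have at most #|T| elements. *)
Definition min_class (T : finType) (F : sgraph T) : nat :=
  \big[minn/#|T|]_(c : {ffun T -> 'I_(chi F)} | proper_coloring F c)
    \big[minn/#|T|]_(i : 'I_(chi F)) #|[set v | c v == i]|.

(* When chi(F) = 1 the quotient below reads 0 * (|F| / 0); the value is then
   taken to be 1, which keeps chi(F) - 1 < chi_cr(F) <= chi(F). *)
Definition chi_cr (R : realType) (T : finType) (F : sgraph T) : R :=
  if chi F == 1 then 1%R
  else (((chi F)%:R - 1) * (#|T|%:R / (#|T|%:R - (min_class F)%:R)))%R.

(* The parts are the fibres of c; they are nonempty. *)
Definition complete_partite (T : finType) (B : sgraph T) k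
    (c : T -> 'I_k) : Prop :=
  (forall i, exists v, c v = i) /\ (forall u v, B u v = (c u != c v)).

Definition interval_labelling (T : finType) k (c : T -> 'I_k)
    (sigma : {perm 'I_k}) (phi : T -> 'I_#|T|) : Prop :=
  bijective phi /\ (forall u v, sigma (c u) < sigma (c v) -> phi u < phi v).

Section Pullback.
Variables (S T : finType) (F : sgraph T) (psi : S -> T).
Let padj : rel S := fun a b => F (psi a) (psi b).
Fact padj_sym : symmetric padj.
Proof. by move=> a b; apply: adj_sym. Qed.
Fact padj_irr : irreflexive padj.
Proof. by move=> a; apply: adj_irr. Qed.
Definition pullback : sgraph S := SGraph padj_sym padj_irr.
End Pullback.

(* There are k.+1 >= 1 parts, the exceptional part U_1 being the one indexed by
   ord0. If psi is the inverse of a labelling phi, then pullback B psi is the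
   ordered graph that phi yields. *)
Definition bottlegraph (R : realType) (x : R) h (H : ordered_graph h)
    (T : finType) (B : sgraph T) : Prop :=
  exists (k : nat) (c : T -> 'I_k.+1),
    [/\ complete_partite B c,
        exists m : nat,
          #|[set v | c v == ord0]| <= m /\
          (forall i, i != ord0 -> #|[set v | c v == i]| = m)
      & forall (sigma : {perm 'I_k.+1}) (phi : T -> 'I_#|T|)
               (psi : 'I_#|T| -> T),
          interval_labelling c sigma phi -> cancel phi psi ->
          has_tiling x H (pullback B psi)].

Definition chi_cr_star (R : realType) (x : R) h (H : ordered_graph h) : R :=
  (* inf set0 = 0 gives density 1 - 1/0 = 1, the value for an infimum +oo. *)
  inf [set y : R | exists (T : finType) (B : sgraph T),
                     bottlegraph x H B /\ y = chi_cr R B]%classic.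

Definition tiling_density (R : realType) (x : R) h (H : ordered_graph h) : R :=
  (1 - 1 / chi_cr_star x H)%R.

(* Main.v *)
(* Linear programming duality is replaced by a discrepancy argument.
   For any real weights on the vertices of a graph with minimum degree at least
   (1 - 1/c)n, picking v_0, v_1, ... greedily among the lightest common
   neighbours gives many cliques whose i-th vertex is no heavier than the
   quantile i/c; weighting the last vertex less than the others gives a bottle
   with critical chromatic number c that is on average no heavier than the
   graph. Let d_v be the discrepancy |N(v) /\ X| - |X||N(v)|/n of the set X
   covered so far. Choosing each new bottle light for the weights
   w(u) = \sum_(v ~ u) d_v keeps \sum_v d_v^2 small, so that almost all
   uncovered vertices keep their proportion of uncovered neighbours and bottles
   can be removed until almost everything is covered. This would only give
   coverage x - o(1); the loss is recovered by mixing in a few complete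
   multipartite graphs with equal parts, for which the coverage is strictly
   better than x. *)

Require Import Defs.
From mathcomp Require Import all_boot all_order all_algebra perm.
From mathcomp Require Import classical_sets reals.
From mathcomp Require Import boolp fintype finset zify ring lra.

Set Implicit Arguments.
Unset Strict Implicit.
Unset Printing Implicit Defensive.

Import Order.TTheory GRing.Theory Num.Theory.

(** * Blow-ups and intervals *)

Lemma pigeonhole_fiber (V K : finType) (f : V -> K) (Y : {set V}) (s0 : K) T :
  #|K| * T <= #|Y| -> exists s, T <= #|[set y in Y | f y == s]|.
Proof.
move=> le_KT; apply/existsP; apply: contraLR le_KT; rewrite negb_exists -ltnNge.
move/forallP => small.
have -> : #|Y| = \sum_(s : K) #|[set y in Y | f y == s]|.
  rewrite -sum1_card (partition_big f predT) //=.
  by apply: eq_bigr => s _; rewrite sum1dep_card cardsE.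
rewrite -sum_nat_const (bigD1 s0) //= [X in _ < X](bigD1 s0) //= -addSn leq_add //.
  by rewrite ltnNge small.
by apply: leq_sum => s _; rewrite ltnW // ltnNge small.
Qed.

(* Instead of a hypergraph version of the Kovari-Sos-Turan theorem: the earlier
   sets are read as [T0] disjoint transversals, each with many extensions, so
   that many vertices extend a common large family of transversals. *)
Lemma rich_blowup (K q T : nat) : exists n0, forall (V : finType) (E : rel V)
    (Z : nat -> {set V}) (D : nat),
  n0 <= #|V| -> #|V| <= q * D ->
  (forall i (v : nat -> V), i < K -> (forall j, j < i -> v j \in Z j) ->
    D <= #|[set y in Z i | [forall j : 'I_i, E (v j) y]]|) ->
  exists U : nat -> {set V},
    (forall i, i < K -> U i \subset Z i /\ T <= #|U i|) /\
    (forall i j a b, i < j -> j < K -> a \in U i -> b \in U j -> E a b).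
Proof.
elim: K T => [|K IHK] T.
  by exists 0 => V E Z D _ _ _; exists (fun=> finset.set0); split => // i j a b _.
case: T => [|T'].
  exists 0 => V E Z D _ _ _; exists (fun=> finset.set0); split => [i _|i j a b _ _].
    by rewrite sub0set.
  by rewrite inE.
(* A vertex outside [Y] extends fewer than [T] of the transversals. With [T0 = 2 q T] such vertices
   account for at most half of the [T0 * D] extensions counted below, hence [D <= 2 #|Y|]. *)
set T := T'.+1; pose T0 := 2 * q * T.
have [n1 IH] := IHK T0; exists (n1 + (2 * q * (2 ^ T0 * T)).+1).
move=> V E Z D le_n leVD rich.
have [|//||U [UZ UE]] := IH V E Z D; first by lia.
  by move=> i v ltiK; apply: rich; lia.
have /card_gt0P[x0 _] : 0 < #|V| by lia.
pose u j t := nth x0 (enum (U j)) t.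
have uU j t : j < K -> t < T0 -> u j t \in U j.
  move=> ltj ltt; rewrite -mem_enum mem_nth // -cardE.
  by apply: leq_trans ltt (proj2 (UZ j ltj)).
pose S y := [set t : 'I_T0 | [forall j : 'I_K, E (u j t) y]].
pose Y := [set y in Z K | T <= #|S y|].
have count_t (t : 'I_T0) : D <= #|[set y in Z K | t \in S y]|.
  have := rich K (fun j => u j t) (ltnSn K); set X := [set y in _ | _] => le_D.
  have -> : [set y in Z K | t \in S y] = X by apply/setP=> y; rewrite !inE.
  by apply: le_D => j ltj; apply: (subsetP (proj1 (UZ j ltj))); apply: uU.
have double_count : T0 * D <= #|Y| * T0 + #|V| * T.
  apply: (@leq_trans (\sum_(t : 'I_T0) #|[set y in Z K | t \in S y]|)).
    rewrite -[T0 in T0 * D]card_ord -sum_nat_const.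
    by apply: leq_sum => t _; apply: count_t.
  have -> : \sum_(t : 'I_T0) #|[set y in Z K | t \in S y]|
            = \sum_(y in Z K) #|S y|.
    transitivity (\sum_(t : 'I_T0) \sum_(y in Z K) (t \in S y : nat)).
      apply: eq_bigr => t _; rewrite -sum1_card big_mkcond [RHS]big_mkcond /=.
      by apply: eq_bigr => y _; rewrite inE; case: (y \in Z K); case: (t \in S y).
    rewrite exchange_big; apply: eq_bigr => y _ /=.
    by rewrite -sum1_card [RHS]big_mkcond.
  rewrite (bigID (mem Y)) /= leq_add //.
    rewrite -[X in X * _]sum1_card big_distrl /= [X in X <= _](eq_bigl (mem Y)); last first.
      by move=> y; rewrite /= !inE; case: (y \in Z K).
    by apply: leq_sum => y _; rewrite mul1n -[X in _ <= X]card_ord max_card.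
  apply: (@leq_trans (\sum_(y : V) T)); last by rewrite sum_nat_const.
  rewrite big_mkcond; apply: leq_sum => y _; case: ifP => // /andP[yZ].
  by rewrite !inE yZ /= -ltnNge => /ltnW.
have T0gt0 : 0 < T0 by rewrite /T0; case: (q) leVD le_n => [|q'] //; lia.
have leDY : D <= 2 * #|Y|.
  rewrite -(leq_pmul2l T0gt0) -(leq_add2r (T0 * D)).
  have : 2 * (#|V| * T) <= T0 * D by rewrite /T0; nia.
  by move: double_count; clear; nia.
have big_Y : #|{set 'I_T0}| * T <= #|Y|.
  have -> : #|{set 'I_T0}| = 2 ^ T0.
    by rewrite -cardsT -powersetT card_powerset cardsT card_ord.
  rewrite -(leq_pmul2l (isT : 0 < 2)); apply: leq_trans leDY.
  have : q * (2 * (2 ^ T0 * T)) <= q * D by apply: leq_trans leVD; move: le_n; clear; nia.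
  by rewrite leq_pmul2l //; move: T0gt0; rewrite /T0; case: (q).
(* There are only [2 ^ T0] families of transversals, so [T] vertices of [Y] extend exactly the same
   family [s]; restricting the earlier sets to [s] finishes the step. *)
have [s les] := @pigeonhole_fiber _ _ S Y finset.set0 T big_Y.
have /card_gt0P[y0] : 0 < #|[set y in Y | S y == s]| by apply: leq_trans les.
rewrite !inE => /andP[/andP[y0Z Tle] /eqP Sy0].
pose U' i := if i < K then [set u i (val t) | t in s] else [set y in Y | S y == s].
exists U'; split => [i|i j a b ltij ltj].
  rewrite ltnS leq_eqVlt => /predU1P[->|ltiK]; rewrite /U' ?ltnn ?ltiK.
    split; last by [].
    by apply/subsetP => y; rewrite !inE => /andP[/andP[]].
  split.
    apply/subsetP => _ /imsetP[t _ ->].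
    by apply: (subsetP (proj1 (UZ i ltiK))); apply: uU => //; apply: ltn_ord.
  rewrite card_in_imset -?Sy0 // => t t' _ _ /eqP.
  have szU (r : 'I_T0) : r < size (enum (U i)).
    by rewrite -cardE; apply: leq_trans (ltn_ord r) (proj2 (UZ i ltiK)).
  by rewrite (nth_uniq x0 (szU t) (szU t')) ?enum_uniq // => /eqP/val_inj.
rewrite /U' (_ : i < K); last by lia.
move=> /imsetP[t ts ->]; case: ifP => [ltjK|/negbT geK].
  by case/imsetP=> t' _ ->; apply: (UE i j) => //; apply: uU (ltn_ord _) => //; lia.
rewrite !inE => /andP[/andP[_ _] /eqP Sb].
move: ts; rewrite -Sb inE => /forallP/(_ (Ordinal (_ : i < K))); apply; lia.
Qed.

(** Sweep from the left and cut at the least [p] below which some set has [M] elements. By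
    minimality every other set has lost at most [M] elements below [p], which explains the factor
    [size I]. The sweep then continues to the right of [p]; the order [J] that results cannot be
    prescribed. *)
Lemma interval_subsets n M (I : seq nat) (U : nat -> {set 'I_n}) :
  uniq I -> (forall i, i \in I -> size I * M <= #|U i|) ->
  exists (J : seq nat) (A : nat -> {set 'I_n}),
    [/\ perm_eq J I,
        forall i, i \in I -> A i \subset U i /\ M <= #|A i|
      & forall a b (u v : 'I_n), a < b -> b < size J ->
          u \in A (nth 0 J a) -> v \in A (nth 0 J b) -> u < v].
Proof.
move sI: (size I) => l; elim: l I U sI => [|l IHl] I U sI uI leU.
  by exists [::], U; case: I sI uI leU.
pose below p i := [set u in U i | u < p].
have ex_p : exists p, has (fun i => M <= #|below p i|) I.
  exists n; apply/hasP; exists (nth 0 I 0); first by rewrite mem_nth ?sI.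
  rewrite (_ : below n _ = U (nth 0 I 0)).
    by apply: leq_trans (leU _ _); rewrite ?mem_nth ?sI //; nia.
  by apply/setP=> u; rewrite inE ltn_ord andbT.
case: (ex_minnP ex_p) => p /hasP[i0 i0I lei0] min_p.
have small i : i \in I -> i != i0 -> l * M <= #|U i :\: below p i|.
  move=> iI _; rewrite cardsD (setIidPr _); last first.
    by apply/subsetP=> u; rewrite inE => /andP[].
  suff : #|below p i| <= M by have := leU i iI; nia.
  case: p min_p {lei0 ex_p} => [|p] min_p.
    by rewrite (_ : below 0 i = finset.set0) ?cards0 //; apply/setP=> u; rewrite !inE andbF.
  have lt : #|below p i| < M.
    rewrite ltnNge; apply/negP => le; suff : p < p by rewrite ltnn.
    by apply: min_p; apply/hasP; exists i.
  apply: leq_trans lt.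
  have [ltp|gep] := ltnP p n.
    apply: (@leq_trans #|Ordinal ltp |: below p i|).
      apply: subset_leq_card; apply/subsetP => u; rewrite !inE -val_eqE /=.
      by case: (u \in U i) => //=; lia.
    by rewrite cardsU1; case: (_ \notin _).
  rewrite (_ : below p.+1 i = below p i) //; apply/setP=> u; rewrite !inE.
  by have := ltn_ord u; case: (u \in U i) => //=; lia.
have s_rem : size (rem i0 I) = l by rewrite size_rem // sI.
have rem_in i : (i \in rem i0 I) = (i != i0) && (i \in I) by rewrite mem_rem_uniq // inE.
have [|i|J [A [pJ AU ltA]]] := IHl (rem i0 I) (fun i => U i :\: below p i) s_rem.
- exact: rem_uniq.
- by rewrite rem_in => /andP[? ?]; apply: small.
have sJ : size J = l by rewrite (perm_size pJ).
exists (i0 :: J), (fun i => if i == i0 then below p i0 else A i); split.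
- by rewrite (perm_trans _ (_ : perm_eq (i0 :: rem i0 I) I)) ?perm_cons // perm_sym perm_to_rem.
- move=> i iI; case: eqP => [->|/eqP ni].
    by split => //; apply/subsetP=> u; rewrite inE => /andP[].
  have [|sA leA] := AU i; first by rewrite rem_in ni.
  by split => //; apply: subset_trans sA (subsetDl _ _).
have Jne b : b < l -> nth 0 J b \in rem i0 I.
  by move=> ltb; rewrite -(perm_mem pJ) mem_nth // sJ.
move=> [|a] [|b] u v //=; rewrite ltnS sJ => ltab ltb; last first.
  have := Jne a (ltn_trans ltab ltb); have := Jne b ltb.
  rewrite !rem_in => /andP[/negbTE-> _] /andP[/negbTE-> _].
  by apply: ltA; rewrite // sJ.
have := Jne b ltb => inJ; rewrite eqxx.
have := inJ; rewrite rem_in => /andP[/negbTE-> _].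
rewrite inE => /andP[_ ltup] /(subsetP (proj1 (AU _ inJ))).
by rewrite !inE => /andP[nb vU]; move: nb; rewrite vU /= -leqNgt; apply: leq_trans.
Qed.

(** * Light quantiles *)

(* Integer form of: if [W] is sorted by weight, then [m theta_i] is at most the
   total weight of the next [m / L] proportion of [W], and likewise
   [s theta_k], up to shifting by one block of [#|W| %/ L] elements. *)
Lemma quantile_thresholds (R : realType) (V : finType) (w : V -> R) (W : {set V})
    (k m s p : nat) (C : R) :
  (forall u, - C <= w u <= C)%R -> 0 < s -> s <= m -> p = #|W| %/ (k * m + s) ->
  k * m + s <= p ->
  exists theta : nat -> R,
    (forall i, i <= k -> (i * m + 1) * p <= #|[set u in W | (w u <= theta i)%R]|) /\
    (m%:R * (\sum_(i < k) theta i) + s%:R * theta k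
       <= (k * m + s)%:R / #|W|%:R * (\sum_(u in W) w u) + 4 * C)%R.
Proof.
move=> wC sgt0 lesm defp leLp; set L := k * m + s in defp leLp *.
have Lgt0 : 0 < L by rewrite /L; lia.
have pgt0 : 0 < p by lia.
have leLpN : L * p <= #|W| by rewrite defp mulnC leq_divM.
have ltN : #|W| < L * p + L by rewrite addnC -mulnS mulnC defp; apply: ltn_ceil.
have [x0 _] : exists x0, x0 \in W by apply/card_gt0P; nia.
pose le u v := (w u <= w v)%R.
pose e := sort le (enum W).
have sz : size e = #|W| by rewrite size_sort -cardE.
have so : sorted le e by apply: sort_sorted => a b; apply: le_total.
have tr : transitive le by move=> b a d; apply: le_trans.
have rf : reflexive le by move=> a; apply: lexx.
pose q r : R := w (nth x0 e r).
have q_mono r r' : r <= r' -> r' < #|W| -> (q r <= q r')%R.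
  move=> lerr ltr; apply: (sorted_leq_nth tr rf x0 so) => //; rewrite inE sz //.
  exact: leq_ltn_trans lerr ltr.
have sumq : (\sum_(u in W) w u = \sum_(0 <= r < #|W|) q r)%R.
  have pe : perm_eq e (enum W) by rewrite perm_sort.
  rewrite -big_enum /= -(perm_big _ pe) /=.
  by rewrite (big_nth x0) sz.
have qC r : (- C <= q r <= C)%R by apply: wC.
(* [theta i] is the last weight in block number [i * m], counted from 0, of [p] consecutive ranks.
   It bounds the next [m] blocks from below, at the price of never using the first block in these
   estimates. *)
pose theta i := q ((i * m + 1) * p).-1.
have lt_rank i : i <= k -> ((i * m + 1) * p).-1 < #|W|.
  move=> leik; have : i * m <= k * m by rewrite leq_mul2r leik orbT.
  move=> leim; have : (i * m + 1) * p <= L * p by rewrite leq_mul2r /L; lia.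
  have : 0 < (i * m + 1) * p by rewrite muln_gt0 pgt0 addn1.
  lia.
have C0 : (0 <= C)%R by have := wC x0; lra.
have block a b t : t < #|W| -> t <= a -> a <= b -> b <= #|W| ->
    ((b - a)%:R * q t <= \sum_(a <= r < b) q r)%R.
  move=> ltt leta leab lebN.
  rewrite mulr_natl -sumr_const_nat [X in (X <= _)%R]big_nat [X in (_ <= X)%R]big_nat.
  by apply: ler_sum => r /andP[ler ltr]; apply: q_mono; lia.
have main : forall j, j <= k -> (p%:R * (m%:R * (\sum_(i < j) theta i)) <=
    \sum_(p <= r < (j * m + 1) * p) q r)%R.
  elim=> [|j IHj] ltjk; first by rewrite big_ord0 !mulr0 mul0n add0n mul1n big_geq.
  have leb : (j.+1 * m + 1) * p <= #|W|.
    have : j.+1 * m <= k * m by rewrite leq_mul2r ltjk orbT.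
    by move: leLpN sgt0; rewrite /L; nia.
  rewrite big_ord_recr /= (big_cat_nat (n := (j * m + 1) * p)) /=; [|nia|nia].
  rewrite !mulrDr lerD //; first by apply: IHj; lia.
  have := @block ((j * m + 1) * p) ((j.+1 * m + 1) * p) ((j * m + 1) * p).-1.
  rewrite (_ : _ - _ = p * m); last by nia.
  by rewrite natrM -mulrA; apply; [apply: lt_rank; lia|lia|nia|].
have leb : (k * m + 1) * p <= L * p by rewrite leq_mul2r /L; lia.
(* Since the first block was skipped, only [s - 1] of the [L] blocks remain; the missing
   [p * theta k] goes into the error. *)
have last_block : (p%:R * ((s%:R - 1) * theta k) <=
    \sum_((k * m + 1) * p <= r < L * p) q r)%R.
  have := @block ((k * m + 1) * p) (L * p) ((k * m + 1) * p).-1.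
  rewrite (_ : _ - _ = p * (s - 1)); last by rewrite /L; nia.
  rewrite natrM natrB // -mulrA; apply; [exact: lt_rank|lia|by []|by []].
have sumW : (\sum_(p <= r < L * p) q r <= \sum_(u in W) w u + p%:R * C + L%:R * C)%R.
  have lep : p <= L * p by nia.
  rewrite sumq (big_cat_nat (n := p) (m := 0) (p := #|W|)) //=; last by lia.
  rewrite (big_cat_nat (n := L * p) (m := p) (p := #|W|)) //=.
  have lo a b : a <= b -> (- ((b - a)%:R * C) <= \sum_(a <= r < b) q r)%R.
    move=> leab; rewrite -mulrN mulr_natl -sumr_const_nat.
    by apply: ler_sum => r _; have /andP[] := qC r.
  have := lo 0 p (leq0n p); have := lo (L * p) #|W| leLpN; rewrite subn0.
  have : ((#|W| - L * p)%:R * C <= L%:R * C)%R.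
    by rewrite ler_wpM2r // ler_nat; lia.
  lra.
exists theta; split => [i leik|].
  apply: (@leq_trans (size (take ((i * m + 1) * p) e))).
    by rewrite size_takel // sz; have := lt_rank i leik; nia.
  rewrite -(card_uniqP _); last by apply: take_uniq; rewrite sort_uniq enum_uniq.
  apply: subset_leq_card; apply/subsetP => u utake.
  have ue := mem_take utake; rewrite inE; move: (ue); rewrite mem_sort mem_enum => -> /=.
  rewrite -(nth_index x0 ue); apply: q_mono; last exact: lt_rank.
  by move: utake; rewrite (in_take _ ue); lia.
have pR : (0 < p%:R :> R)%R by rewrite ltr0n.
have NR : (0 < #|W|%:R :> R)%R by rewrite ltr0n; lia.
rewrite -(ler_pM2l pR).
have total : (p%:R * (m%:R * (\sum_(i < k) theta i) + s%:R * theta k) <=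
   \sum_(u in W) w u + 2 * p%:R * C + L%:R * C)%R.
  have := main k (leqnn k); move: last_block sumW.
  rewrite (big_cat_nat (n := (k * m + 1) * p) (m := p) (p := L * p)) //=; last by nia.
  have : (p%:R * theta k <= p%:R * C)%R by rewrite ler_pM2l //; have /andP[] := qC ((k * m + 1) * p).-1.
  lra.
apply: le_trans total _; set S := (\sum_(u in W) w u)%R.
have SC : (- (#|W|%:R * C) <= S <= #|W|%:R * C)%R.
  rewrite -mulrN !mulr_natl -!sumr_const; apply/andP; split; apply: ler_sum => u _;
  by have /andP[] := wC u.
(* [z] is the fraction of [W] that lies in the [L] full blocks. Replacing the total weight by its
   [z]-fold costs at most [L * C]; with the earlier error [2 p C + L C] and [L <= p] this makes
   [4 p C]. *)
pose z : R := (p%:R * (L%:R / #|W|%:R))%R.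
have zN : (z * #|W|%:R = L%:R * p%:R)%R.
  by rewrite /z mulrA divfK ?lt0r_neq0 // mulrC.
have zle1 : (z <= 1)%R by rewrite -(ler_pM2r NR) zN mul1r -natrM ler_nat.
have zge : ((1 - z) * #|W|%:R <= L%:R)%R.
  rewrite mulrBl zN mul1r lerBlDr addrC -natrM -natrD ler_nat; lia.
have LpR : (L%:R * C <= p%:R * C)%R by rewrite ler_wpM2r // ler_nat.
have : ((1 - z) * S <= (1 - z) * (#|W|%:R * C))%R.
  by apply: ler_wpM2l; [lra|have /andP[] := SC].
have : ((1 - z) * #|W|%:R * C <= L%:R * C)%R by apply: ler_wpM2r.
rewrite mulrDr [X in (_ <= X + _)%R]mulrA -/z; lra.
Qed.

(** * Packings of placements *)

(** A copy of [H] in a complete multipartite graph whose parts are consecutive intervals,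
    remembering only the part of each vertex. Monotonicity is weak because one part may receive
    several consecutive vertices. *)
Definition placement h K (H : ordered_graph h) (f : {ffun 'I_h -> 'I_K}) :=
  (forall i j : 'I_h, i <= j -> f i <= f j) /\ (forall i j, H i j -> f i != f j).

(** Tilings are reduced to vectors of part sizes: unlike tilings of a fixed graph, packings can be
    added and scaled. *)
Definition packs h (H : ordered_graph h) K (a : 'I_K -> nat) (N : nat) : Prop :=
  exists fs : seq {ffun 'I_h -> 'I_K},
    [/\ {in fs, forall f, placement H f}, size fs = N
      & forall q, \sum_(f <- fs) #|[set i | f i == q]| <= a q].

Lemma packs_le h (H : ordered_graph h) K (a b : 'I_K -> nat) N :
  (forall q, a q <= b q) -> packs H a N -> packs H b N.
Proof.
move=> leab [fs [pl sz ld]]; exists fs; split => // q.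
exact: leq_trans (ld q) (leab q).
Qed.

Lemma packs0 h (H : ordered_graph h) K (a : 'I_K -> nat) : packs H a 0.
Proof. by exists [::]; split => // q; rewrite big_nil. Qed.

Lemma packsD h (H : ordered_graph h) K (a b : 'I_K -> nat) N M :
  packs H a N -> packs H b M -> packs H (fun q => a q + b q) (N + M).
Proof.
move=> [fs [plf szf ldf]] [gs [plg szg ldg]]; exists (fs ++ gs); split.
- by move=> f; rewrite mem_cat => /orP[/plf|/plg].
- by rewrite size_cat szf szg.
- by move=> q; rewrite big_cat leq_add.
Qed.

Lemma packsM h (H : ordered_graph h) K (a : 'I_K -> nat) N c :
  packs H a N -> packs H (fun q => c * a q) (c * N).
Proof.
move=> pa; elim: c => [|c IHc]; first exact: packs0.
by apply: packs_le (packsD pa IHc) => q; rewrite mulSn.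
Qed.

Lemma packs_sum h (H : ordered_graph h) K (I : Type) (r : seq I)
    (a : I -> 'I_K -> nat) (N : I -> nat) :
  (forall i, packs H (a i) (N i)) ->
  packs H (fun q => \sum_(i <- r) a i q) (\sum_(i <- r) N i).
Proof.
move=> pa; elim: r => [|i r IHr]; first by rewrite big_nil; apply: packs0.
by rewrite big_cons; apply: packs_le (packsD (pa i) IHr) => q; rewrite big_cons.
Qed.

Lemma sum_fibers h K (fs : seq {ffun 'I_h -> 'I_K}) :
  \sum_q \sum_(f <- fs) #|[set i | f i == q]| = h * size fs.
Proof.
rewrite exchange_big /= mulnC -sum1_size big_distrl /=.
apply: eq_bigr => f _; rewrite mul1n -[RHS]card_ord -sum1_card.
rewrite (partition_big f predT) //=.
by apply: eq_bigr => q _; rewrite sum1dep_card.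
Qed.

Definition interval_blowup n (G : ordered_graph n) K (A : 'I_K -> {set 'I_n}) :=
  forall (p q : 'I_K) (u v : 'I_n), p < q -> u \in A p -> v \in A q -> u < v /\ G u v.

Lemma interval_blowup_inj n (G : ordered_graph n) K (A : 'I_K -> {set 'I_n}) p q u :
  interval_blowup G A -> u \in A p -> u \in A q -> p = q.
Proof.
move=> blow up uq; apply: val_inj; case: (ltngtP p q) => // lt.
  by have [] := blow _ _ _ _ lt up uq; rewrite ltnn.
by have [] := blow _ _ _ _ lt uq up; rewrite ltnn.
Qed.

Lemma interval_blowup_disjoint n (G : ordered_graph n) K (A : 'I_K -> {set 'I_n}) p q :
  interval_blowup G A -> p != q -> [disjoint A p & A q].
Proof.
move=> blow ne; rewrite -setI_eq0; apply/eqP/setP=> u; rewrite !inE.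
by apply: contraNF ne => /andP[up uq]; rewrite (interval_blowup_inj blow up uq).
Qed.

(** The vertices placed in one part are sent to its smallest elements in increasing order, [rk]
    being the rank of a vertex among those sharing its part. Between different parts both the order
    and the edges come from the blow-up. *)
Lemma placement_copy h (H : ordered_graph h) K n (G : ordered_graph n)
    (A : 'I_K -> {set 'I_n}) (f : {ffun 'I_h -> 'I_K}) :
  interval_blowup G A ->
  placement H f -> (forall q, #|[set i | f i == q]| <= #|A q|) ->
  exists C : {set 'I_n}, [/\ is_copy H G C, #|C| = h, C \subset \bigcup_q A q
    & forall q, #|C :&: A q| <= #|[set i | f i == q]|].
Proof.
move=> blow [mono edge] fits.
pose rk (i : 'I_h) := #|[set j : 'I_h | (j < i) && (f j == f i)]|.
have lt_rk i : rk i < #|A (f i)|.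
  apply: leq_trans (fits (f i)); apply: proper_card; apply/properP; split.
    by apply/subsetP => j; rewrite !inE => /andP[].
  by exists i; rewrite !inE // ltnn.
have x0 (i : 'I_h) : 'I_n.
  suff /sigW[x _] : exists x, x \in A (f i) by exact: x.
  by apply/card_gt0P; apply: leq_trans (lt_rk i).
pose phi : {ffun 'I_h -> 'I_n} := [ffun i => nth (x0 i) (enum (A (f i))) (rk i)].
have phiA i : phi i \in A (f i) by rewrite ffunE -mem_enum mem_nth // -cardE.
have sorted_enum q : sorted ltn (map val (enum (A q))).
  rewrite /enum_mem -enumT; apply: (subseq_sorted ltn_trans _ (iota_ltn_sorted 0 n)).
  by rewrite -val_enum_ord map_subseq ?filter_subseq.
have phi_lt (i j : 'I_h) : i < j -> phi i < phi j.
  move=> ltij; have := mono i j (ltnW ltij); rewrite leq_eqVlt => /predU1P[eqf|ltf].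
    have {}eqf : f i = f j by apply: val_inj.
    have ltr : rk i < rk j.
      apply: proper_card; apply/properP; split.
        by apply/subsetP => l; rewrite !inE eqf => /andP[lt ->]; rewrite (ltn_trans lt).
      by exists i; rewrite !inE ?ltnn // ltij eqf /=.
    have szi (l : 'I_h) : f l = f j -> rk l < size (map val (enum (A (f j)))).
      by move=> <-; rewrite size_map -cardE.
    have := sorted_ltn_nth ltn_trans 0 (sorted_enum (f j)).
    move/(_ (rk i) (rk j)); rewrite !inE !szi // => /(_ isT isT ltr).
    rewrite !ffunE (nth_map (x0 i)) -?cardE -?eqf ?lt_rk //.
    by rewrite (nth_map (x0 j)) -?cardE eqf ?lt_rk.
  by have [] := blow _ _ _ _ ltf (phiA i) (phiA j).
have phi_inj : injective phi.
  move=> i j eqp; apply: val_inj; case: (ltngtP i j) => // /phi_lt.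
    by rewrite eqp ltnn.
  by rewrite eqp ltnn.
exists [set phi i | i in 'I_h]; split.
- apply/existsP; exists phi; rewrite eqxx andbT; apply/andP; split.
    by apply/forallP=> i; apply/forallP=> j; apply/implyP; apply: phi_lt.
  apply/forallP=> i; apply/forallP=> j; apply/implyP => Hij.
  have := edge i j Hij; case: (ltngtP (f i) (f j)) => [lt|lt|/val_inj-> /eqP//] _.
    by have [] := blow _ _ _ _ lt (phiA i) (phiA j).
  by rewrite adj_sym; have [] := blow _ _ _ _ lt (phiA j) (phiA i).
- by rewrite card_imset // card_ord.
- by apply/subsetP => _ /imsetP[i _ ->]; apply/bigcupP; exists (f i).
- move=> q; rewrite -(card_imset _ phi_inj); apply: subset_leq_card.
  apply/subsetP => u; rewrite inE => /andP[/imsetP[i _ ->] iq].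
  by apply: imset_f; rewrite inE (interval_blowup_inj blow (phiA i) iq).
Qed.

Lemma is_tilingU h (H : ordered_graph h) n (G : ordered_graph n)
    (P Q : {set {set 'I_n}}) :
  is_tiling H G P -> is_tiling H G Q ->
  finset.cover P :&: finset.cover Q = finset.set0 ->
  is_tiling H G (P :|: Q) /\
  #|finset.cover (P :|: Q)| = #|finset.cover P| + #|finset.cover Q|.
Proof.
move=> /andP[/finset.trivIsetP tP /forallP cP] /andP[/finset.trivIsetP tQ /forallP cQ] dis.
have sub (S : {set {set 'I_n}}) A : A \in S -> A \subset finset.cover S.
  by move=> AS; apply: bigcup_sup.
have disj A B : A \in P -> B \in Q -> [disjoint A & B].
  move=> AP BQ; rewrite -setI_eq0 -subset0 -dis; apply: setISS; exact: sub.
split; last first.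
  rewrite -cardsUI dis cards0 addn0; congr #|pred_of_set _|.
  by rewrite /finset.cover bigcup_setU.
apply/andP; split.
  apply/finset.trivIsetP => A B; rewrite !inE => /orP[AP|AQ] /orP[BP|BQ] ne.
  - exact: tP.
  - exact: disj.
  - by rewrite disjoint_sym disj.
  - exact: tQ.
apply/forallP => A; apply/implyP; rewrite inE => /orP[AP|AQ].
  exact: (implyP (cP A)).
exact: (implyP (cQ A)).
Qed.

Lemma is_tiling0 h (H : ordered_graph h) n (G : ordered_graph n) :
  is_tiling H G finset.set0.
Proof.
apply/andP; split; first by apply/finset.trivIsetP => A B; rewrite inE.
by apply/forallP => A; rewrite inE.
Qed.

Lemma packs_tiling h (H : ordered_graph h) K n (G : ordered_graph n)
    (A : 'I_K -> {set 'I_n}) (a : 'I_K -> nat) N :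
  interval_blowup G A ->
  (forall q, a q <= #|A q|) -> packs H a N ->
  exists P, [/\ is_tiling H G P, finset.cover P \subset \bigcup_q A q
              & #|finset.cover P| = h * N].
Proof.
move=> blow lea [fs [pl <- ld]].
have {lea ld} ld q : \sum_(f <- fs) #|[set i | f i == q]| <= #|A q|.
  exact: leq_trans (ld q) (lea q).
elim: fs A blow pl ld => [|f fs IHfs] A blow pl ld.
  exists finset.set0; split; first exact: is_tiling0.
    by rewrite /finset.cover big_set0 sub0set.
  by rewrite /finset.cover big_set0 cards0 muln0.
have [|q|C [cC sC subC leC]] := placement_copy blow (f := f) (H := H).
- by apply: pl; rewrite mem_head.
- by apply: leq_trans (ld q); rewrite big_cons leq_addr.
have [p q u v ltpq|g gfs|q|P [tP subP sP]] := IHfs (fun q => A q :\: C).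
- rewrite !inE => /andP[_ uA] /andP[_ vA]; exact: blow ltpq uA vA.
- by apply: pl; rewrite inE gfs orbT.
- by rewrite cardsD; have := ld q; have := leC q; rewrite big_cons [A q :&: C]setIC; lia.
have coverC : finset.cover [set C] = C by rewrite /finset.cover big_set1.
have tC : is_tiling H G [set C].
  apply/andP; split; last by apply/forallP=> B; apply/implyP; rewrite inE => /eqP->.
  by apply/finset.trivIsetP => B B'; rewrite !inE => /eqP-> /eqP->; rewrite eqxx.
have [|tU sU] := is_tilingU tC tP.
  apply/setP => u; rewrite coverC !inE; apply/negbTE/andP => -[uC].
  by move=> /(subsetP subP)/bigcupP[q _]; rewrite !inE uC.
exists ([set C] :|: P); split => //.
  rewrite /finset.cover bigcup_setU big_set1 subUset subC /=.
  apply: subset_trans subP _; apply/bigcupsP => q _.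
  by apply: subset_trans (subsetDl _ _) (bigcup_sup q _).
by rewrite sU coverC sC sP mulnS.
Qed.

(** * Bottlegraphs as size vectors *)

Lemma bigminn_le (I : eqType) (r : seq I) (P : pred I) (F : I -> nat) x0 i :
  i \in r -> P i -> \big[minn/x0]_(j <- r | P j) F j <= F i.
Proof.
elim: r => // j r IHr; rewrite inE big_cons => /predU1P[<- ->|ir Pi].
  exact: geq_minl.
by case: (P j); [apply: leq_trans (geq_minr _ _) (IHr ir Pi) | apply: IHr].
Qed.

Lemma bigminn_ge (I : Type) (r : seq I) (P : pred I) (F : I -> nat) x0 s :
  s <= x0 -> (forall i, P i -> s <= F i) -> s <= \big[minn/x0]_(j <- r | P j) F j.
Proof.
move=> sx sF; apply: (big_ind (fun y => s <= y)) => // a b sa sb.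
by rewrite leq_min sa.
Qed.

Section CompletePartite.
Variables (T : finType) (B : sgraph T) (K : nat) (c : T -> 'I_K).
Hypothesis Bc : complete_partite B c.

(** Representatives of the parts form a clique, so their colours are distinct. If there are no
    further colours, a vertex must have the colour of its own representative, being adjacent to all
    the others. *)
Lemma proper_coloring_class j (d : {ffun T -> 'I_j}) : proper_coloring B d ->
  K <= j /\ (j <= K -> forall e, exists i, [set v | c v == i] \subset [set v | d v == e]).
Proof.
case: Bc => surj adjE /forallP dP.
have proper u v : B u v -> d u != d v.
  by move=> Buv; have /forallP/(_ v)/implyP := dP u; apply.
have {}surj i : exists v, c v == i by have [v <-] := surj i; exists v.
pose r i := xchoose (surj i); have cr i : c (r i) = i by apply/eqP/(xchooseP (surj i)).
have inj : injective (fun i => d (r i)).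
  move=> i i' eqd; apply/eqP; apply: contraT => ne.
  by have := proper (r i) (r i'); rewrite adjE !cr ne eqd eqxx => /(_ isT).
have leKj : K <= j by rewrite -[K]card_ord -[j]card_ord; apply: leq_card inj.
split => // lejK e; have eqK : K = j by apply/eqP; rewrite eqn_leq leKj.
have onto e' : exists i, d (r i) = e'.
  have [|i ->] := codomP (inj_card_onto inj _ e'); last by exists i.
  by rewrite !card_ord.
have [i di] := onto e; exists i; apply/subsetP => v; rewrite !inE => /eqP cv.
have [i' di'] := onto (d v); have [eqi|ne] := eqVneq i i'.
  by rewrite -di' -eqi di.
by have := proper v (r i'); rewrite adjE cr cv ne di' eqxx => /(_ isT).
Qed.

Lemma chi_complete_partite : chi B = K.
Proof.
rewrite /chi; case: ex_minnP => j /existsP[d dP] minj.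
apply/eqP; rewrite eqn_leq (proj1 (proper_coloring_class dP)) andbT.
apply: minj; apply/existsP; exists [ffun v => c v].
apply/forallP=> u; apply/forallP=> v; apply/implyP.
by case: Bc => _ ->; rewrite !ffunE.
Qed.

Lemma min_class_complete_partite s : (forall i, s <= #|[set v | c v == i]|) ->
  s <= #|T| -> s <= min_class B.
Proof.
move=> les leT; apply: bigminn_ge => // d dP; apply: bigminn_ge => // e _.
have [_ sub] := proper_coloring_class dP.
have {sub} [|i sub] := sub _ e; first by rewrite chi_complete_partite.
exact: leq_trans (les i) (subset_leq_card sub).
Qed.

(** This keeps the denominator in [chi_cr] positive: vertices of two different parts never share a
    colour class. *)
Lemma min_class_lt : 1 < K -> min_class B < #|T|.
Proof.
case: (Bc) => surj adjE; move=> K1.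
have [v0 c0] := surj (Ordinal (ltnW K1)); have [v1 c1] := surj (Ordinal K1).
have : colorable B (chi B) by rewrite /chi; case: ex_minnP.
case/existsP=> d dP; rewrite /min_class.
apply: leq_ltn_trans; first exact: bigminn_le (mem_index_enum d) dP.
apply: leq_ltn_trans; first exact: bigminn_le (mem_index_enum (d v0)) isT.
rewrite -cardsT; apply: proper_card; apply/properP; split; first exact: subsetT.
exists v1; rewrite ?inE //.
have /forallP/(_ v1)/forallP/(_ v0)/implyP := dP; apply.
by rewrite adjE c0 c1.
Qed.
End CompletePartite.

(** Sorting the vertices by the position of their part yields a labelling to which the universal
    condition on bottlegraphs can be applied. *)
Lemma interval_labelling_ex (T : finType) (x0 : T) K (c : T -> 'I_K) (sigma : {perm 'I_K}) :
  exists (phi : T -> 'I_#|T|) (psi : 'I_#|T| -> T),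
    interval_labelling c sigma phi /\ cancel phi psi.
Proof.
pose le u v := sigma (c u) <= sigma (c v).
pose e := sort le (enum T).
have sz : size e = #|T| by rewrite size_sort -cardE.
have ein u : u \in e by rewrite mem_sort mem_enum.
have lt_ix u : index u e < #|T| by rewrite -sz index_mem.
pose phi u := Ordinal (lt_ix u); pose psi (i : 'I_#|T|) := nth x0 e i.
have phiK : cancel phi psi by move=> u; apply: nth_index.
have psiK : cancel psi phi.
  by move=> i; apply: val_inj; rewrite /= index_uniq ?sort_uniq ?enum_uniq ?sz.
exists phi, psi; split => //; split; first by exists psi.
move=> u v lt_uv; rewrite ltnNge; apply/negP => /= le_vu.
have tr : transitive le by move=> b a d; apply: leq_trans.
have rf : reflexive le by move=> a; apply: leqnn.
have so : sorted le e by apply: sort_sorted => a b; apply: leq_total.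
have := sorted_leq_nth tr rf x0 so (index v e) (index u e).
rewrite !inE !index_mem !ein !nth_index // => /(_ isT isT le_vu).
by rewrite /le leqNgt lt_uv.
Qed.

(** In an interval labelling the position of the part is monotone in the label, so each copy of the
    tiling gives a placement. Disjointness of the copies bounds the load of a part by its size. *)
Lemma tiling_packs (R : realType) (x : R) h (H : ordered_graph h) (T : finType)
    (B : sgraph T) K (c : T -> 'I_K) (sigma : {perm 'I_K}) phi psi :
  complete_partite B c -> interval_labelling c sigma phi -> cancel phi psi ->
  has_tiling x H (pullback B psi) ->
  exists N, packs H (fun q => #|[set v | sigma (c v) == q]|) N /\
            (x * #|T|%:R <= (h * N)%:R)%R.
Proof.
move=> [_ adjE] [bij lab] phiK [P /andP[tP /forallP cP] leP].
have psiK : cancel psi phi by move=> a; case: bij => g _ gK; rewrite -{1}(gK a) phiK gK.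
pose pos a := sigma (c (psi a)).
have pos_mono (a b : 'I_#|T|) : a <= b -> pos a <= pos b.
  move=> leab; rewrite leqNgt; apply/negP => /lab.
  by rewrite !psiK ltnNge leab.
pose em (A : {set 'I_#|T|}) (g : {ffun 'I_h -> 'I_#|T|}) :=
  embedding H (pullback B psi) g && (A == [set g i | i in 'I_h]).
have exg A : A \in P -> exists g, em A g by move=> AP; apply/existsP; apply: (implyP (cP A)).
have emP A g : em A g -> [/\ forall i j : 'I_h, i < j -> g i < g j,
    forall i j, H i j -> pos (g i) != pos (g j) & A = [set g i | i in 'I_h]].
  move=> /andP[/andP[/forallP mono /forallP edge] /eqP->]; split=> // i j.
    by move=> ij; have /forallP/(_ j)/implyP := mono i; apply.
  move=> ij; have /forallP/(_ j)/implyP/(_ ij) := edge i.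
  by rewrite /= adjE /pos (inj_eq perm_inj).
have injg A g : em A g -> injective g.
  move=> /emP[mono _ _] i j eqg; apply: val_inj.
  by case: (ltngtP i j) => // /mono; rewrite eqg ltnn.
have list_placements (As : seq {set 'I_#|T|}) : {subset As <= P} ->
    exists fs : seq {ffun 'I_h -> 'I_K}, [/\ {in fs, forall f, placement H f},
      \sum_(A <- As) #|A| = h * size fs
      & forall q, \sum_(f <- fs) #|[set i | f i == q]|
                  <= \sum_(A <- As) \sum_(a in A) (pos a == q)].
  elim: As => [|A As IHAs] sAs.
    by exists [::]; split => // [|q]; rewrite ?big_nil ?muln0.
  have [|fs [pl sz ld]] := IHAs; first by move=> B' B'in; apply: sAs; rewrite inE B'in orbT.
  have [g emg] := exg A (sAs A (mem_head _ _)); have [mono edge eqA] := emP A g emg.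
  exists ([ffun i => pos (g i)] :: fs); split.
  - move=> f; rewrite inE => /predU1P[->|]; last exact: pl.
    split=> i j; rewrite !ffunE; last exact: edge.
    rewrite leq_eqVlt => /predU1P[/val_inj->//|/mono/ltnW]; exact: pos_mono.
  - by rewrite big_cons sz mulnS eqA card_imset ?card_ord //; apply: injg emg.
  - move=> q; rewrite !big_cons leq_add // eqA big_imset /=; last first.
      by move=> i j _ _ /(injg _ _ emg).
    rewrite -[X in X <= _]sum1_card [X in X <= _]big_mkcond /=; apply: leq_sum => i _.
    by rewrite inE ffunE; case: eqP.
have [|fs [pl sz ld]] := list_placements (enum P).
  by move=> A; rewrite mem_enum.
rewrite !big_enum /= in sz ld; exists (size fs); split; last first.
  by rewrite -sz; move: tP; rewrite /finset.trivIset => /eqP->.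
exists fs; split => // q; apply: leq_trans (ld q) _; rewrite big_enum /=.
rewrite -(finset.big_trivIset (E := fun a => (pos a == q) : nat) _ tP) /=.
apply: (@leq_trans #|[set a | pos a == q]|).
  rewrite -[X in _ <= X]sum1_card [X in _ <= X]big_mkcond [X in X <= _]big_mkcond /=.
  by apply: leq_sum => a _; rewrite inE; case: (a \in _); case: (_ == q).
rewrite -(card_imset _ (can_inj psiK)); apply: subset_leq_card.
by apply/subsetP => _ /imsetP[a ap ->]; move: ap; rewrite !inE.
Qed.

Lemma card_fibers (T : finType) K (c : T -> 'I_K) :
  #|T| = \sum_i #|[set v | c v == i]|.
Proof.
rewrite -sum1_card (partition_big c predT) //=.
by apply: eq_bigr => i _; rewrite sum1dep_card.
Qed.

(** As all parts but one have the same size, a permutation of the parts matters only through the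
    position [i] that the exceptional part takes. *)
Definition bottle k m s (i : 'I_k.+1) : 'I_k.+1 -> nat :=
  fun q => if q == i then s else m.

Lemma sum_bottle k m s (i : 'I_k.+1) : \sum_q bottle m s i q = k * m + s.
Proof.
rewrite (bigD1 i) //= /bottle eqxx addnC (eq_bigr (fun=> m)) => [|q /negbTE->//].
by rewrite sum_nat_const cardC1 card_ord.
Qed.

(** From here on a bottlegraph is just three numbers. The transposition of [ord0] and [i] brings the
    small part to position [i]. *)
Lemma bottlegraph_packs (R : realType) (x : R) h (H : ordered_graph h)
    (T : finType) (B : sgraph T) : bottlegraph x H B ->
  exists k m s, [/\ 0 < m, s <= m, s < m -> 0 < k,
    forall i : 'I_k.+1, exists N, packs H (bottle m s i) N /\
      (x * (k * m + s)%:R <= (h * N)%:R)%R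
    & ((k * m + s)%:R / m%:R <= chi_cr R B)%R].
Proof.
move=> [k [c [Bc [m0 [les0 eqm0]] tilB]]]; pose s := #|[set v | c v == ord0]|.
have sgt0 : 0 < s.
  by case: (Bc) => surj _; have [v cv] := surj ord0; apply/card_gt0P; exists v; rewrite inE cv.
(* With a single part the given bound on its size may be too large; choosing [m = s] makes the ratio
   1, the value of [chi_cr] in that case. *)
have [m [mgt0 lesm eqm mk]] : exists m, [/\ 0 < m, s <= m,
    forall i, i != ord0 -> #|[set v | c v == i]| = m & k = 0 -> m = s].
  have [k0|kgt0] := posnP k.
    exists s; split => // i; have := ltn_ord i; rewrite {2}k0 => i1.
    by rewrite -val_eqE /=; lia.
  by exists m0; split => //; [apply: leq_trans les0 | move=> k0; rewrite k0 in kgt0].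
have cardc i : #|[set v | c v == i]| = bottle m s ord0 i.
  by rewrite /bottle; have [->|/eqm] := eqVneq i ord0.
have cardT : #|T| = k * m + s.
  by rewrite (card_fibers c) -(sum_bottle m s ord0); apply: eq_bigr => i _; apply: cardc.
exists k, m, s; split => // [|i0|].
  by case: (k) mk => // -> //; rewrite ltnn.
  have [/card_gt0P[v0 _]] : 0 < #|T| by lia.
  have [phi [psi [lab phiK]]] := interval_labelling_ex v0 c (tperm ord0 i0).
  have [N [pN leN]] := tiling_packs Bc lab phiK (tilB _ _ _ lab phiK).
  exists N; rewrite -cardT; split => //; apply: packs_le pN => q.
  rewrite (_ : [set v | _] = [set v | c v == tperm ord0 i0 q]); last first.
    by apply/setP=> v; rewrite !inE -(inj_eq (@perm_inj _ (tperm ord0 i0)) _ q) tpermK.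
  rewrite cardc /bottle.
  by case: tpermP => [->|->|/eqP/negbTE-> /eqP/negbTE->]; rewrite ?eqxx // eq_sym.
rewrite /chi_cr (chi_complete_partite Bc); case: eqP => [[k0]|/eqP k1].
  by rewrite k0 mul0n (mk k0) divff // pnatr_eq0; lia.
(* Every colour class has at least [s] vertices, so with [L = k m + s] the denominator [L - mc] is
   at most [k m], and [L / m <= k L / (L - mc)]. *)
have := @min_class_complete_partite _ _ _ _ Bc s; set mc := min_class B => le_mc.
have {}le_mc : s <= mc.
  apply: le_mc; last by lia.
  by move=> i; rewrite cardc /bottle; case: ifP.
have lt_mc : mc < #|T| by apply: (min_class_lt Bc); lia.
rewrite cardT in lt_mc *; rewrite -natr1 addrK -natrB ?(ltnW lt_mc) //.
rewrite mulrA -natrM ler_pdivrMr ?ltr0n // mulrAC ler_pdivlMr ?ltr0n ?subn_gt0 //.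
by rewrite -!natrM ler_nat; nia.
Qed.

(** * Gaining coverage *)

(* A small part of maximal size is traded for an additional empty part. *)
Lemma packs_lift h (H : ordered_graph h) K (i : 'I_K.+1) (a : 'I_K -> nat)
    (b : 'I_K.+1 -> nat) N :
  (forall q, a q <= b (lift i q)) -> packs H a N -> packs H b N.
Proof.
move=> leab [fs [pl sz ld]].
pose up (f : {ffun 'I_h -> 'I_K}) : {ffun 'I_h -> 'I_K.+1} := [ffun j => lift i (f j)].
exists (map up fs); split.
- move=> _ /mapP[f ffs ->]; have [mono edge] := pl f ffs.
  split=> j l; rewrite !ffunE; last by rewrite (inj_eq lift_inj); apply: edge.
  by move=> /mono; rewrite /= /bump; lia.
- by rewrite size_map.
- move=> q; rewrite big_map; have [->|ne] := eqVneq q i.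
    rewrite big1 // => f _; apply/eqP; rewrite cards_eq0; apply/eqP/setP=> j.
    by rewrite !inE ffunE eq_sym; apply/negbTE/neq_lift.
  rewrite eq_sym in ne; have [q' -> _] := unlift_some ne.
  apply: leq_trans (leab q'); apply: leq_trans (ld q').
  by apply: leq_sum => f _; apply: subset_leq_card; apply/subsetP => j;
    rewrite !inE ffunE (inj_eq lift_inj).
Qed.

(* For equal parts the coverage is strictly better than for bottles. A packing
   of [a] either is almost perfect or leaves [j = L (m - s)] vertices of some
   part [q] uncovered; then [2 a = (a - j e_q) + (a + j e_q)] gains [x j],
   because [L (m - s) e_q = m \sum_i b_i - L b_q] shows that [a + j e_q] is a
   nonnegative combination of the bottles [b_i]. *)
Lemma packs_equal_parts (R : realType) (x : R) h (H : ordered_graph h) k m s :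
  (0 < x < 1)%R -> 0 < k -> s < m ->
  (forall i : 'I_k.+1, exists N, packs H (bottle m s i) N /\
      (x * (k * m + s)%:R <= (h * N)%:R)%R) ->
  exists M N, [/\ 0 < M, packs H (fun _ : 'I_k.+1 => M) N
    & (x * (k.+1 * M)%:R + x <= (h * N)%:R)%R].
Proof.
move=> /andP[x0 x1] kgt0 ltsm /fin_all_exists[Nb pb]; set L := k * m + s in pb.
pose D := \sum_i Nb i.
have pS : packs H (fun _ : 'I_k.+1 => L) D.
  apply: packs_le (packs_sum (index_enum _) (fun i => (pb i).1)) => q.
  rewrite -[L](sum_bottle m s q); apply: leq_sum => i _.
  by rewrite /bottle eq_sym.
have valS : (x * (k.+1 * L)%:R <= (h * D)%:R)%R.
  rewrite /D big_distrr /= natr_sum mulnC natrM mulr_natr mulrnAr.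
  rewrite -[k.+1 in X in (X <= _)%R]card_ord -sumr_const.
  by apply: ler_sum => i _; apply: (pb i).2.
pose j := L * (m - s).
have Lgt0 : 0 < L by rewrite /L; nia.
have jgt0 : 0 < j by rewrite /j muln_gt0 Lgt0 subn_gt0.
have [c0 c0P] : exists c0 : nat, (j.+1%:R <= (1 - x) * c0%:R)%R.
  exists (Num.truncn (j.+1%:R / (1 - x))).+1.
  rewrite -ler_pdivrMl ?subr_gt0 // mulrC; apply/ltW/truncnS_gt.
(* [c >= L] makes the truncated subtraction in [co] exact. [c >= c0] serves the almost perfect case:
   if every part misses fewer than [j] vertices, the loss is outweighed by the factor [1 - x]. *)
pose c := maxn c0 L.
have cP : (j.+1%:R <= (1 - x) * c%:R)%R.
  apply: le_trans c0P _; rewrite ler_pM2l ?subr_gt0 // ler_nat; exact: leq_maxl.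
have lecL : L <= c by apply: leq_maxr.
have [fs [pl sz ld]] := packsM c pS.
have [/existsP[q leq]|none] := boolP [exists q, \sum_(f <- fs) #|[set i | f i == q]| + j <= c * L].
  pose co (i : 'I_k.+1) := c + m - (i == q) * L.
  have pN : packs H (fun r => \sum_i co i * bottle m s i r) (\sum_i co i * Nb i).
    by apply: packs_sum => i; apply: packsM; apply: (pb i).1.
  have pfs : packs H (fun r : 'I_k.+1 => c * L - (r == q) * j) (c * D).
    exists fs; split => // r; have := ld r; have [->|ne] := eqVneq r q; last by rewrite mul0n subn0.
    by rewrite mul1n; lia.
  have sum_co r : \sum_i co i * bottle m s i r + L * bottle m s q r = (c + m) * L.
    rewrite -[in RHS](sum_bottle m s r : _ = L) big_distrr /= (bigD1 q) //= [RHS](bigD1 q) //=.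
    rewrite addnAC; congr (_ + _).
      rewrite /co eqxx mul1n mulnBl subnK ?leq_mul2r ?(leq_trans lecL) ?leq_addr ?orbT //.
      by rewrite /bottle eq_sym.
    by apply: eq_bigr => i /negbTE ne; rewrite /co ne mul0n subn0 /bottle eq_sym.
  exists (2 * (c * L)), (c * D + \sum_i co i * Nb i); split.
  - by rewrite !muln_gt0 Lgt0 (leq_trans Lgt0 lecL).
  - apply: packs_le (packsD pfs pN) => r; have := sum_co r.
    have := leq; have -> : (c + m) * L = c * L + L * m by ring.
    rewrite /bottle /j mulnBr; have : L * s <= L * m by rewrite leq_mul2l (ltnW ltsm) orbT.
    by case: (r == q); rewrite ?mul1n ?mul0n; lia.
  have val2 : (x * (k.+1 * (c * L) + j)%:R <= (h * \sum_i co i * Nb i)%:R)%R.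
    have sumco : (\sum_i co i) * L = k.+1 * (c * L) + j.
      have : \sum_i co i + L = k.+1 * (c + m).
        rewrite (bigD1 q) //= addnAC {1}/co eqxx mul1n subnK ?(leq_trans lecL) ?leq_addr //.
        rewrite (eq_bigr (fun=> c + m)) => [|i /negbTE ne]; last by rewrite /co ne mul0n subn0.
        by rewrite sum_nat_const cardC1 card_ord mulSn.
      by rewrite /j mulnBr /L; move: (ltnW ltsm); nia.
    rewrite -sumco natrM natr_sum big_distrl big_distrr big_distrr /= natr_sum.
    apply: ler_sum => i _; rewrite mulnCA natrM mulrCA ler_wpM2l ?ler0n //.
    by apply: (pb i).2.
  have val1 : (x * (k.+1 * (c * L))%:R <= (h * (c * D))%:R)%R.
    have -> : k.+1 * (c * L) = c * (k.+1 * L) by ring.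
    have -> : h * (c * D) = c * (h * D) by ring.
    by rewrite !(natrM _ c) mulrCA ler_wpM2l ?ler0n.
  have : (x <= x * j%:R)%R by rewrite ler_peMr ?ler1n // ltW.
  have -> : k.+1 * (2 * (c * L)) = k.+1 * (c * L) + k.+1 * (c * L) by ring.
  rewrite [h * (_ + _)]mulnDr; move: val1 val2.
  move: (k.+1 * (c * L)) (h * (c * D)) (h * _) => A B C.
  rewrite !natrD !mulrDr; lra.
exists (2 * (c * L)), (2 * (c * D)); split.
- by rewrite !muln_gt0 Lgt0 (leq_trans Lgt0 lecL).
- by apply: packsM; exists fs.
have big : k.+1 * (c * L) <= h * (c * D) + k.+1 * j.
  have sc y : k.+1 * y = \sum_(q : 'I_k.+1) y by rewrite sum_nat_const card_ord.
  rewrite -sz -sum_fibers !sc -big_split /=.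
  apply: leq_sum => r _; move: none; rewrite negb_exists => /forallP/(_ r).
  by rewrite -ltnNge => /ltnW.
have : (k.+1%:R * j.+1%:R <= k.+1%:R * ((1 - x) * c%:R) :> R)%R by rewrite ler_pM2l ?ltr0n.
have : (k.+1%:R * ((1 - x) * c%:R) <= (1 - x) * (k.+1 * (c * L))%:R :> R)%R.
  rewrite mulrCA ler_pM2l ?subr_gt0 // -natrM ler_nat; nia.
have k1 : (1 <= k.+1%:R :> R)%R by rewrite ler1n.
have -> : k.+1 * (2 * (c * L)) = k.+1 * (c * L) + k.+1 * (c * L) by ring.
have -> : h * (2 * (c * D)) = h * (c * D) + h * (c * D) by ring.
have := big; rewrite -(ler_nat R).
move: (k.+1 * (c * L)) (h * (c * D)) => A B.
rewrite (natrD _ A) (natrD _ B) (natrD _ B) natrM -(natr1 j).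
nra.
Qed.

(** Mix [P] bottles with one complete multipartite graph with parts of size [M]. The latter lifts
    the coverage above [x], and for large [P] it barely changes the ratio. *)
Lemma bottlegraph_gain (R : realType) (x zeta : R) h (H : ordered_graph h)
    (T : finType) (B : sgraph T) :
  (0 < x < 1)%R -> (0 < zeta)%R -> bottlegraph x H B ->
  (1 <= chi_cr R B)%R /\
  exists k m s, [/\ 0 < k, 0 < s, s <= m,
    exists2 xi : R, (0 < xi)%R & forall i : 'I_k.+1, exists N,
      packs H (bottle m s i) N /\ (x * (1 + xi) * (k * m + s)%:R <= (h * N)%:R)%R
    & ((k * m + s)%:R / m%:R <= chi_cr R B + zeta)%R].
Proof.
move=> x01 zeta0 /bottlegraph_packs[k0 [m [s0 [mgt0 les0 k0P pb0 leB]]]].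
have mR : (0 < m%:R :> R)%R by rewrite ltr0n.
(* A bottle with [s0 = m] is read as having [k0.+1] full parts and an empty one, of the same total
   size, so that [s < m] may be assumed. *)
have [k [s [kgt0 ltsm pb eqL]]] : exists k s, [/\ 0 < k, s < m,
    forall i : 'I_k.+1, exists N, packs H (bottle m s i) N /\
      (x * (k * m + s)%:R <= (h * N)%:R)%R & k * m + s = k0 * m + s0].
  move: les0; rewrite leq_eqVlt => /predU1P[eqs|lts]; last first.
    by exists k0, s0; split => //; apply: k0P.
  have eqL : k0.+1 * m + 0 = k0 * m + s0 by rewrite eqs mulSn; lia.
  exists k0.+1, 0; split => // i; rewrite eqL; have [N [pN leN]] := pb0 ord0.
  exists N; split => //; apply: (packs_lift (i := i)) pN => q.
  rewrite /bottle eqs if_same; case: ifP => // /eqP eqi.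
  by have := neq_lift i q; rewrite eqi eqxx.
rewrite -eqL in leB; set L := k * m + s in pb leB.
have lekL : k * m <= L by apply: leq_addr.
split.
  apply: le_trans leB; rewrite ler_pdivlMr // mul1r ler_nat.
  by apply: leq_trans lekL; rewrite leq_pmull.
have [M [N [Mgt0 pM valM]]] := packs_equal_parts x01 kgt0 ltsm pb.
(* The equal parts bring [k.+1 * M <= zeta * P] vertices, so the ratio of the total to the largest
   part exceeds the old one by at most [zeta]. *)
pose P := (Num.truncn (k.+1%:R * M%:R / zeta)).+1.
have leP : (k.+1%:R * M%:R <= zeta * P%:R)%R.
  by rewrite -ler_pdivrMl // mulrC; apply/ltW/truncnS_gt.
have eqL' : k * (P * m + M) + (P * s + M) = P * L + k.+1 * M by rewrite /L; ring.
exists k, (P * m + M), (P * s + M); rewrite eqL'; split => //.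
- by rewrite addn_gt0 Mgt0 orbT.
- by rewrite leq_add2r leq_mul2l (ltnW ltsm) orbT.
(* With [xi] the inverse of the total size, the factor [1 + xi] amounts to the additive gain [x]
   from the equal parts. *)
- exists ((P * L + k.+1 * M)%:R^-1)%R.
    by rewrite invr_gt0 ltr0n addn_gt0 !muln_gt0 Mgt0 orbT.
  move=> i; have [Ni [pNi valNi]] := pb i.
  exists (P * Ni + N); split.
    apply: packs_le (packsD (packsM P pNi) pM) => q.
    by rewrite /bottle; case: ifP.
  rewrite -mulrA mulrDl mul1r mulVf; last first.
    by rewrite pnatr_eq0 -lt0n addn_gt0 !muln_gt0 Mgt0 orbT.
  have -> : h * (P * Ni + N) = P * (h * Ni) + h * N by ring.
  have : (P%:R * (x * L%:R) <= P%:R * (h * Ni)%:R)%R by rewrite ler_wpM2l.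
  move: valM; move: (k.+1 * M) (h * Ni) (h * N) => A b c.
  by rewrite (natrD _ _ A) (natrD _ _ c) !(natrM _ P); lra.
- rewrite ler_pdivrMr ?ltr0n ?addn_gt0 ?Mgt0 ?orbT //.
  rewrite ler_pdivrMr // in leB.
  have m1 : (1 <= m%:R :> R)%R by rewrite ler1n.
  have : (P%:R * L%:R <= P%:R * (chi_cr R B * m%:R))%R by rewrite ler_wpM2l.
  have c0 : (0 <= chi_cr R B)%R.
    by rewrite -(pmulr_lge0 _ mR); apply: le_trans leB.
  have : (zeta * P%:R <= zeta * P%:R * m%:R)%R.
    by rewrite ler_peMr // mulr_ge0 // ltW.
  have := mulr_ge0 c0 (ler0n R M); have := mulr_ge0 (ltW zeta0) (ler0n R M).
  move: (k.+1) leP eqL' => K leP _; clearbody P L.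
  rewrite !natrD !natrM; lra.
Qed.

Lemma packs_scale h (H : ordered_graph h) k m s (i : 'I_k.+1) N Q :
  packs H (bottle m s i) N -> packs H (bottle (Q * m) (Q * s) i) (Q * N).
Proof.
move=> /(packsM Q); apply: packs_le => q.
by rewrite /bottle; case: ifP.
Qed.

(** * Discrepancy *)

Section Discrepancy.
Variables (R : realType) (n : nat) (G : ordered_graph n).
Implicit Types X Y : {set 'I_n}.
Local Open Scope ring_scope.

Definition discrepancy (X : {set 'I_n}) (v : 'I_n) : R :=
  #|[set u in X | G v u]|%:R - #|X|%:R / n%:R * (degree G v)%:R.

Definition vweight (X : {set 'I_n}) (u : 'I_n) : R :=
  \sum_v discrepancy X v * (G v u)%:R.

Lemma discrepancyU X Y v : [disjoint X & Y] ->
  discrepancy (X :|: Y) v = discrepancy X v + discrepancy Y v.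
Proof.
move=> dis; have cardU (A B : {set 'I_n}) : [disjoint A & B] -> #|A :|: B|%:R = #|A|%:R + #|B|%:R :> R.
  by move=> /setDidPl dAB; rewrite -natrD -cardsUI (_ : A :&: B = finset.set0) ?cards0 ?addn0 //;
     apply/eqP; rewrite setI_eq0; apply/setDidPl.
rewrite /discrepancy cardU // (_ : [set u in X :|: Y | G v u] =
  [set u in X | G v u] :|: [set u in Y | G v u]); last first.
  by apply/setP=> u; rewrite !inE andb_orl.
rewrite cardU; last first.
  by apply: disjointWl (disjointWr _ dis); apply/subsetP=> u; rewrite inE => /andP[].
by ring.
Qed.

Lemma discrepancy_le X v : `|discrepancy X v| <= #|X|%:R.
Proof.
have le1 : (#|[set u in X | G v u]| <= #|X|)%N.
  by apply: subset_leq_card; apply/subsetP=> u; rewrite inE => /andP[].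
have le2 : (degree G v <= n)%N by rewrite -[X in (_ <= X)%N]card_ord max_card.
pose z : R := #|X|%:R / n%:R * (degree G v)%:R.
have z0 : 0 <= z by apply: mulr_ge0; [apply: divr_ge0|]; apply: ler0n.
have zX : z <= #|X|%:R.
  rewrite /z -mulrA ler_piMr ?ler0n //.
  have ngt0 : (0 < n)%N := leq_ltn_trans (leq0n v) (ltn_ord v).
  by rewrite mulrC ler_pdivrMr ?ltr0n // mul1r ler_nat.
move: le1; rewrite -(ler_nat R) ler_norml /discrepancy -/z => le1.
have := ler0n R #|[set u in X | G v u]|; lra.
Qed.

(** The inner product of two discrepancies becomes linear in [Y]: it measures by how much the weight
    of [Y] exceeds its proportional share. *)
Lemma sum_discrepancyM X Y : \sum_v discrepancy X v * discrepancy Y v =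
  \sum_(u in Y) vweight X u - #|Y|%:R / n%:R * \sum_u vweight X u.
Proof.
have cnt (Z : {set 'I_n}) v : #|[set u in Z | G v u]|%:R = \sum_(u in Z) (G v u)%:R :> R.
  rewrite -sum1_card natr_sum big_mkcond [RHS]big_mkcond.
  by apply: eq_bigr => u _; rewrite inE; case: (u \in Z); case: (G v u).
have deg v : (degree G v)%:R = \sum_u (G v u)%:R :> R.
  rewrite /degree (_ : [set w | G v w] = [set u in setT | G v u]) ?cnt.
    by apply: eq_bigl => u; rewrite inE.
  by apply/setP => u; rewrite !inE.
rewrite /vweight exchange_big /= [X in _ - _ * X]exchange_big /= mulr_sumr -sumrB.
apply: eq_bigr => v _; rewrite {2}/discrepancy cnt deg mulrBr -!mulr_sumr.
by congr (_ - _); rewrite mulrCA.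
Qed.

(** For [Y = X] the inner product is a sum of squares, hence nonnegative: [X] is at least as heavy
    as average and its complement at most as heavy. A set [Y] light relative to the complement is
    therefore light relative to the whole, and the cross term is at most [E]. *)
Lemma sum_sqr_discrepancyU X Y E : (0 < #|~: X|)%N -> [disjoint X & Y] ->
  \sum_(u in Y) vweight X u
    <= #|Y|%:R / #|~: X|%:R * (\sum_(u in ~: X) vweight X u) + E ->
  \sum_v discrepancy (X :|: Y) v ^+ 2
    <= \sum_v discrepancy X v ^+ 2 + 2 * E + n%:R * #|Y|%:R ^+ 2.
Proof.
move=> Wgt0 dis leE; set T := \sum_u vweight X u; set SW := \sum_(u in ~: X) _ in leE.
have WR : 0 < #|~: X|%:R :> R by rewrite ltr0n.
have cardW : #|X|%:R + #|~: X|%:R = n%:R :> R by rewrite -natrD cardsC card_ord.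
have nR : 0 < n%:R :> R by rewrite -cardW ltr_wpDl.
have T_eq : T = \sum_(u in X) vweight X u + SW.
  rewrite /T (bigID (mem X)) /=; congr (_ + _).
  by apply: eq_bigl => u; rewrite inE.
have sq : \sum_v discrepancy X v ^+ 2 = \sum_(u in X) vweight X u - #|X|%:R / n%:R * T.
  by rewrite -sum_discrepancyM; apply: eq_bigr => v _; rewrite expr2.
have sq0 : 0 <= \sum_v discrepancy X v ^+ 2 by apply: sumr_ge0 => v _; apply: sqr_ge0.
have leW : SW / #|~: X|%:R <= T / n%:R.
  rewrite ler_pdivrMr //; have -> : T / n%:R * #|~: X|%:R = T - #|X|%:R / n%:R * T.
    rewrite (_ : #|~: X|%:R = n%:R - #|X|%:R); last by rewrite -cardW; ring.
    by field; rewrite lt0r_neq0.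
  by rewrite {1}T_eq; lra.
have cross : \sum_v discrepancy X v * discrepancy Y v <= E.
  rewrite sum_discrepancyM -/T; apply: le_trans (lerD leE (lexx _)) _.
  have : #|Y|%:R * (SW / #|~: X|%:R) <= #|Y|%:R * (T / n%:R) by rewrite ler_wpM2l.
  lra.
have sqY : \sum_v discrepancy Y v ^+ 2 <= n%:R * #|Y|%:R ^+ 2.
  rewrite -[n in n%:R]card_ord mulr_natl -sumr_const; apply: ler_sum => v _.
  by rewrite -real_normK ?num_real // lerXn2r ?nnegrE ?normr_ge0 ?ler0n ?discrepancy_le.
rewrite (eq_bigr (fun v => discrepancy X v ^+ 2 +
   (2 * (discrepancy X v * discrepancy Y v) + discrepancy Y v ^+ 2))); last first.
  by move=> v _; rewrite discrepancyU //; ring.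
by rewrite !big_split /= -mulr_sumr; lra.
Qed.

(** Cauchy-Schwarz in the form [|d| <= (d^2 / c + c) / 2] with [c = t n]. *)
Lemma vweight_le X (t : R) : 0 < t -> (0 < n)%N ->
  \sum_v discrepancy X v ^+ 2 <= t ^+ 2 * n%:R ^+ 3 ->
  forall u, - (t * n%:R ^+ 2) <= vweight X u <= t * n%:R ^+ 2.
Proof.
move=> t0 ngt0 leS u; rewrite -ler_norml.
have nR : 0 < n%:R :> R by rewrite ltr0n.
pose c := t * n%:R; have c0 : 0 < c by apply: mulr_gt0.
apply: le_trans (ler_norm_sum _ _ _) _.
apply: (@le_trans _ _ (\sum_v (discrepancy X v ^+ 2 / c + c) / 2)).
  apply: ler_sum => v _; rewrite normrM; set d := discrepancy X v.
  apply: (@le_trans _ _ `|d|); first by rewrite ler_piMr //; case: (G v u); rewrite ?normr0 ?normr1.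
  rewrite -(ler_pM2r c0) -real_normK ?num_real //; move: `|d| => z.
  have -> : (z ^+ 2 / c + c) / 2 * c = (z ^+ 2 + c ^+ 2) / 2 by field; rewrite lt0r_neq0.
  have := sqr_ge0 (z - c); nra.
rewrite -mulr_suml big_split /= -mulr_suml sumr_const card_ord -mulr_natl.
have : (\sum_v discrepancy X v ^+ 2) / c <= t * n%:R ^+ 2.
  by rewrite ler_pdivrMr // (le_trans leS) // /c le_eqVlt; apply/orP; left; apply/eqP; ring.
rewrite /c; lra.
Qed.

(** Chebyshev's inequality. *)
Lemma card_large_discrepancy X (b S : R) : 0 < b -> \sum_v discrepancy X v ^+ 2 <= S ->
  #|[set v | b < `|discrepancy X v|]|%:R * b ^+ 2 <= S.
Proof.
move=> b0; apply: le_trans; rewrite mulr_natl -sumr_const big_mkcond /=.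
apply: ler_sum => v _; rewrite inE; case: ifP => [ltb|_]; last exact: sqr_ge0.
by rewrite -[X in _ <= X]real_normK ?num_real // lerXn2r ?nnegrE ?normr_ge0 ?(ltW ltb) ?(ltW b0).
Qed.

(** A vertex with discrepancy [d] has [|W| deg / n - d] neighbours in the uncovered set [W]. Here
    [d <= eta |W|], which the slack [eta] in the degree absorbs. *)
Lemma card_nonneighbours X v (r eta b : R) :
  (0 < n)%N -> (r + eta) * n%:R <= (degree G v)%:R ->
  `|discrepancy X v| <= b * n%:R -> b * n%:R <= eta * #|~: X|%:R ->
  #|[set u in ~: X | ~~ G v u]|%:R <= (1 - r) * #|~: X|%:R.
Proof.
move=> ngt0 leD; rewrite ler_norml => /andP[_ led] leb.
have nR : 0 < n%:R :> R by rewrite ltr0n.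
have cardW : #|X|%:R + #|~: X|%:R = n%:R :> R by rewrite -natrD cardsC card_ord.
have degE : (#|[set u in X | G v u]| + #|[set u in ~: X | G v u]| = degree G v)%N.
  rewrite -cardsUI (_ : _ :&: _ = finset.set0) ?cards0 ?addn0 //; last first.
    by apply/setP=> u; rewrite !inE; case: (u \in X); rewrite ?andbF.
  by apply: eq_card => u; rewrite !inE; case: (u \in X); rewrite ?orbF.
have splitW : (#|[set u in ~: X | G v u]| + #|[set u in ~: X | ~~ G v u]| = #|~: X|)%N.
  rewrite -cardsUI (_ : _ :&: _ = finset.set0) ?cards0 ?addn0 //; last first.
    by apply/setP=> u; rewrite !inE; case: (G v u); rewrite ?andbF.
  by apply: eq_card => u; rewrite !inE; case: (u \in X); case: (G v u).
move: degE splitW => /(congr1 (fun i => i%:R : R)) + /(congr1 (fun i => i%:R : R)).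
rewrite !natrD => degE splitW; move: led; rewrite /discrepancy => led.
have eqX : #|X|%:R / n%:R * (degree G v)%:R =
    (degree G v)%:R - #|~: X|%:R * ((degree G v)%:R / n%:R) :> R.
  by rewrite (_ : #|X|%:R = n%:R - #|~: X|%:R); [field; rewrite lt0r_neq0 | rewrite -cardW; ring].
have leDn : r + eta <= (degree G v)%:R / n%:R by rewrite ler_pdivlMr.
have : #|~: X|%:R * (r + eta) <= #|~: X|%:R * ((degree G v)%:R / n%:R) by rewrite ler_wpM2l.
lra.
Qed.
End Discrepancy.

(** * Greedy tiling *)

Lemma subset_of_card (T : finType) (S : {set T}) c : c <= #|S| ->
  exists A : {set T}, A \subset S /\ #|A| = c.
Proof.
move=> lec; exists [set x in take c (enum S)]; split.
  by apply/subsetP => x; rewrite inE => /mem_take; rewrite mem_enum.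
rewrite cardsE (card_uniqP _) ?take_uniq ?enum_uniq // size_takel //.
by rewrite -cardE.
Qed.

Lemma card_bigcup_le (T : finType) i (F : 'I_i -> {set T}) c :
  (forall j, #|F j| <= c) -> #|\bigcup_j F j| <= i * c.
Proof.
move=> leF; rewrite -[i in i * c]card_ord -sum_nat_const.
apply: (@leq_trans (\sum_j #|F j|)); last by apply: leq_sum.
elim/big_ind2: _ => [|A a B b leA leB|//]; first by rewrite cards0.
by apply: leq_trans (leq_add leA leB); rewrite leq_card_setU.
Qed.

(** The order of the intervals is dictated by the graph and recorded by [pi]. The small part is
    taken from the last set, wherever that lands, which is why packings are required for every
    position [i]. *)
Lemma blowup_of_rich_sets n (G : ordered_graph n) k m s (U : nat -> {set 'I_n}) :
  s <= m -> (forall i, i <= k -> k.+1 * m <= #|U i|) ->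
  (forall i j a b, i < j -> j <= k -> a \in U i -> b \in U j -> G a b) ->
  exists (i : 'I_k.+1) (A : 'I_k.+1 -> {set 'I_n}) (pi : {perm 'I_k.+1}),
    [/\ interval_blowup G A, forall q, #|A q| = bottle m s i q,
        forall q, A q \subset U (pi q) & pi i = ord_max].
Proof.
move=> lesm leU adjU.
have [i|J [A [pJ AU ltA]]] := @interval_subsets n m (iota 0 k.+1) U (iota_uniq _ _).
  by rewrite mem_iota size_iota add0n ltnS => /andP[_]; apply: leU.
have sJ : size J = k.+1 by rewrite (perm_size pJ) size_iota.
have Jin q : q < k.+1 -> nth 0 J q < k.+1.
  move=> ltq; have : nth 0 J q \in J by rewrite mem_nth // sJ.
  by rewrite (perm_mem pJ) mem_iota.
have uJ : uniq J by rewrite (perm_uniq pJ) iota_uniq.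
pose f (q : 'I_k.+1) := Ordinal (Jin q (ltn_ord q)).
have f_inj : injective f.
  move=> q r /(congr1 val)/= /eqP; rewrite nth_uniq ?sJ // => /eqP; exact: val_inj.
pose pi := perm f_inj; pose i := (pi^-1)%g ord_max.
have pii : pi i = ord_max by rewrite permKV.
have piE q : pi q = nth 0 J q :> nat by rewrite permE.
have Ain q := AU (pi q) _.
have /fin_all_exists[A' A'P] : forall q : 'I_k.+1, exists B : {set 'I_n},
    B \subset A (pi q) /\ #|B| = bottle m s i q.
  move=> q; apply: subset_of_card; apply: leq_trans (proj2 (AU _ _)).
    by rewrite /bottle; case: ifP.
  by rewrite mem_iota add0n ltn_ord.
have A'U q : A' q \subset U (pi q).
  apply: subset_trans (proj1 (A'P q)) (proj1 (AU _ _)).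
  by rewrite mem_iota add0n ltn_ord.
exists i, A', pi; split => //; last by move=> q; case: (A'P q).
move=> p q u v ltpq uA vA; split.
  apply: (ltA p q) => //; first by rewrite sJ.
    by rewrite -piE; apply: (subsetP (proj1 (A'P p))).
  by rewrite -piE; apply: (subsetP (proj1 (A'P q))).
have uU := subsetP (A'U p) _ uA; have vU := subsetP (A'U q) _ vA.
case: (ltngtP (pi p) (pi q)) => [lt|lt|/val_inj/perm_inj eqpq].
- by apply: adjU uU vU => //; rewrite -ltnS.
- by rewrite adj_sym; apply: adjU vU uU => //; rewrite -ltnS.
- by rewrite eqpq ltnn in ltpq.
Qed.

(** Vertices of small discrepancy miss about a fraction [m / L] of the uncovered set, so any [i] of
    them leave many common neighbours among the lightest [(i m + 1) p] vertices. A blow-up of such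
    greedy cliques is a light bottle. The error is [4 C] with [C = 16 n^2 / L], the bound on the
    weights. *)
Lemma tile_step (R : realType) (k m s e : nat) (eta : R) :
  0 < k -> 0 < s -> s <= m -> 0 < e -> (0 < eta)%R ->
  (1024 * e%:R ^+ 3 / eta ^+ 2 <= (k * m + s)%:R)%R ->
  exists n0, forall n (G : ordered_graph n) (X : {set 'I_n}), n0 <= n ->
    (forall v, (1 - m%:R / (k * m + s)%:R + eta) * n%:R <= (degree G v)%:R :> R)%R ->
    n <= e * #|~: X| ->
    (\sum_v discrepancy R G X v ^+ 2 <= (16 / (k * m + s)%:R) ^+ 2 * n%:R ^+ 3)%R ->
  exists (i : 'I_k.+1) (A : 'I_k.+1 -> {set 'I_n}),
    [/\ interval_blowup G A, forall q, #|A q| = bottle m s i q,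
        forall q, A q \subset ~: X
      & (\sum_(u in \bigcup_q A q) vweight R G X u <=
         (k * m + s)%:R / #|~: X|%:R * (\sum_(u in ~: X) vweight R G X u)
         + 64 / (k * m + s)%:R * n%:R ^+ 2)%R].
Proof.
move=> kgt0 sgt0 lesm egt0 eta0; set L := k * m + s => leL.
have Lgt0 : 0 < L by rewrite /L addn_gt0 sgt0 orbT.
have LR : (0 < L%:R :> R)%R by rewrite ltr0n.
have [n1 rich] := rich_blowup k.+1 (2 * e * L) (k.+1 * m).
exists (n1 + 8 * e * L ^ 2) => n G X le_n deg leW leS.
pose W := ~: X; pose p := #|W| %/ L; rewrite -/W in leW *.
have leLpN : p * L <= #|W| by rewrite leq_divM.
have ltN : #|W| < p * L + L by rewrite -mulSnr ltn_ceil.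
have ngt0 : 0 < n by apply: leq_trans le_n; rewrite addn_gt0 !muln_gt0 egt0 Lgt0 orbT.
have nR : (0 < n%:R :> R)%R by rewrite ltr0n.
have leLp : 2 * L <= p.
  rewrite leq_divRL //.
  have : e * (8 * L ^ 2) <= e * #|W|.
    by apply: leq_trans leW; apply: leq_trans le_n; rewrite mulnCA mulnA leq_addl.
  by rewrite leq_pmul2l // => le8; rewrite -mulnA mulnn; lia.
have tau0 : (0 < 16 / L%:R :> R)%R by rewrite divr_gt0.
have wC := vweight_le tau0 ngt0 leS.
have [//|//|//||theta [lowN sum_theta]] := quantile_thresholds (W := W) (k := k) (m := m) (s := s) (p := p) wC.
  by apply: leq_trans leLp; rewrite leq_pmull.
pose b : R := (eta / e%:R * n%:R)%R.
have eR : (0 < e%:R :> R)%R by rewrite ltr0n.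
have b0 : (0 < b)%R by rewrite !mulr_gt0 ?invr_gt0.
pose bad := [set v | (b < `|discrepancy R G X v|)%R].
(* Chebyshev gives [#|bad| <= 256 e^2 n / (L^2 eta^2)]; the assumed lower bound on [L] is exactly
   what turns this into the claim. *)
have le_bad : 4 * e * L * #|bad| <= n.
  have := card_large_discrepancy b0 leS; rewrite -/bad.
  rewrite -(ler_nat R) natrM.
  have -> : (b ^+ 2 = (eta ^+ 2 / e%:R ^+ 2) * n%:R ^+ 2)%R.
    by rewrite /b; field; rewrite lt0r_neq0.
  have -> : ((16 / L%:R) ^+ 2 * n%:R ^+ 3 = 256 / L%:R ^+ 2 * n%:R * n%:R ^+ 2 :> R)%R.
    by field; rewrite lt0r_neq0.
  rewrite mulrA ler_pM2r ?exprn_gt0 //.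
  have eta2 : (0 < eta ^+ 2)%R by rewrite exprn_gt0.
  move: leL; rewrite ler_pdivrMr // => leL.
  rewrite mulrA ler_pdivrMr ?exprn_gt0 // => lebad.
  rewrite -(ler_pM2r (mulr_gt0 (mulr_gt0 LR eta2) LR)).
  have : (L%:R ^+ 2 * (#|bad|%:R * eta ^+ 2) <= 256 * n%:R * e%:R ^+ 2)%R.
    have := ler_wpM2l (sqr_ge0 (L%:R : R)) lebad.
    rewrite (_ : L%:R ^+ 2 * (256 / L%:R ^+ 2 * n%:R * e%:R ^+ 2) = 256 * n%:R * e%:R ^+ 2 :> R)%R //.
    by field; rewrite lt0r_neq0.
  move=> h1.
  have h2 : (4 * e%:R * L%:R * (L%:R ^+ 2 * (#|bad|%:R * eta ^+ 2)) <=
      4 * e%:R * L%:R * (256 * n%:R * e%:R ^+ 2))%R.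
    by apply: ler_wpM2l h1; rewrite !mulr_ge0 // ltW.
  have h3 : (1024 * e%:R ^+ 3 * (n%:R * L%:R) <= L%:R * eta ^+ 2 * (n%:R * L%:R))%R.
    by rewrite ler_wpM2r // mulr_ge0 // ltW.
  rewrite !natrM; nra.
have nonnb v : v \notin bad -> #|[set u in W | ~~ G v u]| <= p.+1 * m.
  rewrite inE -leNgt => led.
  have := card_nonneighbours (X := X) (b := (eta / e%:R)%R) ngt0 (deg v) led.
  rewrite -/W => /(_ _)le_non.
  have {le_non} : (#|[set u in W | ~~ G v u]|%:R <= (1 - (1 - m%:R / L%:R)) * #|W|%:R :> R)%R.
    apply: le_non; rewrite -mulrA ler_pM2l // ler_pdivrMl //.
    by rewrite -natrM ler_nat.
  rewrite subKr -mulrAC ler_pdivlMr // -!natrM ler_nat => le_non.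
  rewrite -(leq_pmul2r Lgt0); apply: leq_trans le_non _.
  by rewrite mulnC -mulnA [m * L]mulnC mulnA leq_mul2r mulSn [L + _]addnC (ltnW ltN) orbT.
pose Z i := [set u in W | (vweight R G X u <= theta i)%R] :\: bad.
(* Earlier vertices exclude at most [i (p + 1) m] of the [(i m + 1) p] lightest ones. At least
   [p - i m >= p - L] remain, before the bad ones are removed. *)
pose D := p - L - #|bad|.
have leVD : #|'I_n| <= 2 * e * L * D.
  rewrite card_ord /D.
  have : e * #|W| <= e * (p * L + L) by rewrite leq_mul2l (ltnW ltN) orbT.
  have : 8 * e * L ^ 2 <= n by apply: leq_trans le_n; rewrite leq_addl.
  have -> : 8 * e * L ^ 2 = 8 * (e * (L * L)) by ring.
  rewrite mulnBr mulnBr.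
  have -> : 2 * e * L * p = 2 * (e * (p * L)) by ring.
  have -> : 2 * e * L * L = 2 * (e * (L * L)) by ring.
  have le1 : e * L <= e * (L * L) by rewrite leq_mul2l leq_pmulr ?orbT.
  move: le_bad; have -> : 4 * e * L * #|bad| = 2 * (2 * e * L * #|bad|) by ring.
  rewrite mulnDr; move: leW le1; clear.
  move: (e * _) (e * L) (e * (L * L)) (e * (p * L)) (2 * e * L * _) => y1 y2 y3 y4 y5; clear; lia.
have [|//|i v ltik vZ|U [UZ UE]] := rich _ (G : rel 'I_n) Z D.
- by rewrite card_ord; apply: leq_trans le_n; apply: leq_addr.
- set Low := [set u in W | (vweight R G X u <= theta i)%R].
  set Good := [set y in Z i | _].
  pose F (j : 'I_i) := [set u in W | ~~ G (v j) u].
  have le1 : #|\bigcup_j F j| <= i * (p.+1 * m).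
    apply: card_bigcup_le => j; apply: nonnb.
    by have := vZ j (ltn_ord j); rewrite inE => /andP[].
  have sub : Low \subset Good :|: (bad :|: \bigcup_j F j).
    apply/subsetP => y yLow; rewrite !inE.
    have [//|nbad] := boolP (b < _)%R; rewrite ?orbT //.
    have [//|nF] := boolP (y \in \bigcup_j F j); rewrite ?orbT ?orbF //.
    move: yLow; rewrite !inE => /andP[yW ->]; rewrite yW /=.
    apply/forallP => j; apply: contraR nF => nG; apply/bigcupP; exists j => //.
    by move: yW; rewrite !inE => ->.
  have arith : forall low gu bf g bd f x y p0 L0 : nat, x + p0 <= low -> low <= gu ->
    gu <= g + bf -> bf <= bd + f -> f <= x + y -> y <= L0 -> p0 - L0 - bd <= g by clear; lia.
  have low : i * m * p + p <= #|Low| by have := lowN i ltik; rewrite mulnDl mul1n.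
  have le2 : #|\bigcup_j F j| <= i * m * p + i * m.
    by rewrite (_ : _ + _ = i * (p.+1 * m)) //; ring.
  apply: (arith _ _ _ _ _ _ _ _ _ _ low (subset_leq_card sub)
    (leq_card_setU _ _).1 (leq_card_setU _ _).1 le2).
  by apply: leq_trans (leq_addr s _); rewrite leq_mul2r -ltnS ltik orbT.
have [||i [A [pi [blow cardA subA pii]]]] := @blowup_of_rich_sets n G k m s U lesm.
- by move=> i leik; case: (UZ i leik).
- by move=> i j a c ltij lejk; apply: UE.
have AZ q : A q \subset Z (pi q).
  by apply: subset_trans (subA q) _; case: (UZ (pi q) (ltn_ord _)).
exists i, A; split => //.
  by move=> q; apply: subset_trans (AZ q) _; apply/subsetP=> u; rewrite !inE => /and3P[].
have -> : (64 / L%:R * n%:R ^+ 2 = 4 * (16 / L%:R * n%:R ^+ 2) :> R)%R by ring.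
apply: le_trans sum_theta.
rewrite (finset.partition_disjoint_bigcup _ _ (fun q r => interval_blowup_disjoint blow)).
(* Vertices of [A q] weigh at most [theta (pi q)]. Reindexing by [pi] pairs the small part with
   [theta k] and gives the left side of the quantile bound. *)
apply: (@le_trans _ _ (\sum_q (bottle m s i q)%:R * theta (pi q))%R).
  apply: ler_sum => q _; rewrite -cardA mulr_natl -sumr_const.
  by apply: ler_sum => u /(subsetP (AZ q)); rewrite !inE => /and3P[].
rewrite (eq_bigr (fun q => (if pi q == ord_max then s else m)%:R * theta (pi q)))%R; last first.
  by move=> q _; rewrite /bottle -pii (inj_eq perm_inj).
rewrite -(reindex_inj (@perm_inj _ pi) (P := predT) (F := fun r : 'I_k.+1 => (if r == ord_max then s else m)%:R * theta r)%R) /=.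
rewrite big_ord_recr /= eqxx mulr_sumr lerD2r le_eqVlt; apply/orP; left; apply/eqP.
apply: eq_bigr => j _; rewrite ifF //; apply/negbTE; rewrite -val_eqE /=.
by rewrite neq_ltn ltn_ord.
Qed.

(** The bound on the squares sustains itself. Each step adds at most [2 * 64 n^2 / L + n L^2], and
    there are at most [n / L] steps, so the total stays below
    [128 n^3 / L^2 + n^2 L <= (16 / L)^2 n^3] as soon as [L^3 <= n]. *)
Lemma greedy_tiling (R : realType) h (H : ordered_graph h) (k m s e : nat) (eta y : R) :
  0 < k -> 0 < s -> s <= m -> 0 < e -> (0 < eta)%R ->
  (1024 * e%:R ^+ 3 / eta ^+ 2 <= (k * m + s)%:R)%R ->
  (forall i : 'I_k.+1, exists N, packs H (bottle m s i) N /\ (y <= (h * N)%:R)%R) ->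
  exists n0, forall n (G : ordered_graph n), n0 <= n ->
    (forall v, (1 - m%:R / (k * m + s)%:R + eta) * n%:R <= (degree G v)%:R :> R)%R ->
    forall j, j * (k * m + s) + (n %/ e).+1 <= n ->
  exists (X : {set 'I_n}) (P : {set {set 'I_n}}),
    [/\ #|X| = j * (k * m + s), is_tiling H G P, finset.cover P \subset X,
        (y * j%:R <= #|finset.cover P|%:R)%R
      & (\sum_v discrepancy R G X v ^+ 2 <= j%:R *
          (128 / (k * m + s)%:R * n%:R ^+ 2 + n%:R * (k * m + s)%:R ^+ 2))%R].
Proof.
move=> kgt0 sgt0 lesm egt0 eta0 leL pb.
have [n1 step] := tile_step kgt0 sgt0 lesm egt0 eta0 leL.
set L := k * m + s in leL step *.
have Lgt0 : 0 < L by rewrite /L addn_gt0 sgt0 orbT.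
have LR : (0 < L%:R :> R)%R by rewrite ltr0n.
exists (n1 + L ^ 3) => n G le_n deg; elim=> [|j IHj] le_j.
  exists finset.set0, finset.set0; split => //.
  - by rewrite cards0.
  - exact: is_tiling0.
  - by rewrite /finset.cover big_set0 sub0set.
  - by rewrite mulr0 ler0n.
  - rewrite mul0r big1 // => v _; apply/eqP; rewrite expf_eq0 /= -normr_le0.
    by apply: le_trans; [exact: discrepancy_le | rewrite cards0].
rewrite mulSn in le_j.
have [|X [P [cardX tP subP leP leS]]] := IHj; first by apply: leq_trans le_j; rewrite -addnA leq_addl.
have cardW : (#|X| + #|~: X| = n)%N by rewrite cardsC card_ord.
(* The reserve of [(n %/ e).+1] vertices keeps a fraction [1 / e] of the graph uncovered before each
   step. *)
have leW : n <= e * #|~: X|.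
  apply: leq_trans (ltnW (ltn_ceil n egt0)) _.
  by rewrite mulnC leq_mul2l; apply/orP; right; move: cardW; rewrite cardX; move: le_j; clear; lia.
have lejL : j * L <= n by rewrite -cardX -[X in _ <= X]card_ord max_card.
have nR : (0 < n%:R :> R)%R by rewrite ltr0n; apply: leq_trans le_j; rewrite addnS.
have leL3 : (L%:R ^+ 3 <= n%:R :> R)%R.
  by rewrite -natrX ler_nat; apply: leq_trans le_n; rewrite leq_addl.
have leS2 : (\sum_v discrepancy R G X v ^+ 2 <= (16 / L%:R) ^+ 2 * n%:R ^+ 3)%R.
  apply: le_trans leS _; rewrite -(ler_pM2l LR) mulrA [(L%:R * j%:R)%R]mulrC -natrM.
  apply: (@le_trans _ _ (n%:R * (128 / L%:R * n%:R ^+ 2 + n%:R * L%:R ^+ 2))%R).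
    rewrite ler_wpM2r ?ler_nat // addr_ge0 // mulr_ge0 ?exprn_ge0 ?ler0n //.
    by rewrite divr_ge0 // ler0n.
  have -> : (L%:R * ((16 / L%:R) ^+ 2 * n%:R ^+ 3) = n%:R * (128 / L%:R * n%:R ^+ 2 + 128 / L%:R * n%:R ^+ 2) :> R)%R.
    by field; rewrite lt0r_neq0.
  rewrite ler_pM2l // lerD2l.
  have -> : (128 / L%:R * n%:R ^+ 2 = n%:R * (128 * n%:R / L%:R) :> R)%R by ring.
  by rewrite ler_pM2l // ler_pdivlMr // -exprSr; lra.
have [|i [A [blow cardA subA sumA]]] := step n G X _ deg leW leS2.
  by apply: leq_trans le_n; apply: leq_addr.
have [N [pN leN]] := pb i.
have [|Q [tQ subQ cardQ]] := packs_tiling blow _ pN; first by move=> q; rewrite cardA.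
pose Y := \bigcup_q A q.
have cardY : #|Y| = L.
  rewrite -sum1_card (finset.partition_disjoint_bigcup _ _ (fun q r => interval_blowup_disjoint blow)) -[RHS](sum_bottle m s i).
  by apply: eq_bigr => q _; rewrite sum1_card cardA.
have disXY : [disjoint X & Y].
  rewrite disjoint_sym disjoints_subset; apply/bigcupsP => q _; exact: subA.
have disPQ : finset.cover P :&: finset.cover Q = finset.set0.
  apply/eqP; rewrite setI_eq0; apply: disjointWl subP _; exact: disjointWr subQ _.
have [tU cardU] := is_tilingU tP tQ disPQ.
exists (X :|: Y), (P :|: Q); split => //.
- by rewrite cardsU disjoint_setI0 // cards0 subn0 cardX cardY mulSn addnC.
- rewrite /finset.cover bigcup_setU; apply: setUSS => //.
- by rewrite cardU natrD -natr1 mulrDr mulr1 lerD // cardQ.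
- have := @sum_sqr_discrepancyU R n G X Y (64 / L%:R * n%:R ^+ 2)%R.
  rewrite cardY => /(_ _ disXY sumA)le; apply: le_trans (le _) _.
    by rewrite -(ltn_pmul2l egt0) muln0; apply: leq_trans leW; rewrite -(ltr0n R).
  rewrite -natr1 mulrDl mul1r; move: leS; lra.
Qed.

(** * Choice of the bottlegraph and of the parameters *)

Lemma min_degree_le (T : finType) (G : sgraph T) v : min_degree G <= degree G v.
Proof. exact: bigminn_le (mem_index_enum v) isT. Qed.

Theorem theorem1p16 (R : realType) (h : nat) (H : ordered_graph h)
    (x : R) (hx0 : (0 < x)%R) (hx1 : (x < 1)%R)
    (eta : R) (heta : (0 < eta)%R) :
  exists n0 : nat, forall (n : nat) (G : ordered_graph n),
    n0 <= n ->
    ((tiling_density x H + eta) * n%:R <= (min_degree G)%:R)%R ->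
    has_tiling x H G.
Proof.
have x01 : (0 < x < 1)%R by rewrite hx0.
pose E := [set y : R | exists (T : finType) (B : sgraph T),
                     bottlegraph x H B /\ y = chi_cr R B]%classic.
have [[y0 Ey0]|E0] := pselect (exists y, E y); last first.
  (* Without bottlegraphs the infimum is 0 and, as division by 0 gives 0, the density is 1; minimum
     degree [(1 + eta) n] is then impossible. *)
  exists 1 => n G ngt0 deg.
  have infE : chi_cr_star x H = 0%R.
    by rewrite /chi_cr_star -/E (_ : E = classical_sets.set0) ?inf0 //; apply/seteqP; split=> y // Ey; case: E0; exists y.
  have nR : (0 < n%:R :> R)%R by rewrite ltr0n.
  have le_n : ((min_degree G)%:R <= n%:R :> R)%R.
    rewrite ler_nat; apply: leq_trans (min_degree_le G (Ordinal ngt0)) _.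
    by rewrite -[X in _ <= X]card_ord max_card.
  have := le_trans deg le_n; rewrite /tiling_density infE invr0 mulr0 subr0.
  by rewrite mulrDl mul1r gerDl leNgt mulr_gt0.
have lb1 : lbound E 1%R.
  by move=> _ [T [B [bB ->]]]; have [] := bottlegraph_gain x01 heta bB.
have hasE : has_inf E.
  by split; [exists y0 | exists 1%R].
have inf1 : (1 <= inf E)%R by apply: lb_le_inf => //; exact: hasE.1.
have eta4 : (0 < eta / 4)%R by rewrite divr_gt0.
have [_ [T [B [bB ->]]] ltB] := inf_adherent eta4 hasE.
have [_ [k [m [s [kgt0 sgt0 lesm [xi xi0 pb] leB]]]]] := bottlegraph_gain x01 eta4 bB.
(* This [e] satisfies [(1 + xi) (1 - 2 / e) >= 1]: the gain in coverage pays for a fraction [2 / e]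
   of vertices outside the bottles. *)
pose e := (Num.truncn (2 * (1 + xi) / xi)).+1.
have leE : (2 * (1 + xi) <= e%:R * xi)%R.
  by rewrite -ler_pdivrMr //; apply/ltW/truncnS_gt.
have eta2 : (0 < eta / 2)%R by rewrite divr_gt0.
(* Scaling by [Q] preserves the ratio and the coverage of the bottle and makes it as large as the
   greedy step demands. *)
pose Q := (Num.truncn (1024 * e%:R ^+ 3 / (eta / 2) ^+ 2 : R)).+1.
have leQ : (1024 * e%:R ^+ 3 / (eta / 2) ^+ 2 <= Q%:R :> R)%R by apply/ltW/truncnS_gt.
set L0 := k * m + s in pb leB.
have L0gt0 : 0 < L0 by rewrite /L0 addn_gt0 sgt0 orbT.
pose L := k * (Q * m) + Q * s.
have LE : L = Q * L0 by rewrite /L /L0; ring.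
have mgt0 : 0 < m by apply: leq_trans lesm.
have [||||||n1 greedy] := @greedy_tiling R h H k (Q * m) (Q * s) e (eta / 2) (x * (1 + xi) * L%:R) kgt0.
- by rewrite muln_gt0.
- by rewrite leq_mul2l lesm orbT.
- by [].
- by [].
- by apply: le_trans leQ _; rewrite -/L LE ler_nat leq_pmulr.
- move=> i; have [N [pN leN]] := pb i; exists (Q * N); split; first exact: packs_scale.
  have -> : h * (Q * N) = Q * (h * N) by rewrite mulnCA.
  by rewrite LE (natrM _ Q L0) (natrM _ Q (h * N)) mulrCA ler_wpM2l.
exists (n1 + e * (L + 2)) => n G le_n deg.
have ngt0 : 0 < n by apply: leq_trans le_n; rewrite addn_gt0 muln_gt0 addn2 orbT.
have nR : (0 < n%:R :> R)%R by rewrite ltr0n.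
pose J := (n - (n %/ e).+1) %/ L.
have Lgt0 : 0 < L by rewrite LE muln_gt0.
have leJ : J * L <= n - (n %/ e).+1 by apply: leq_divM.
have ltJ : n - (n %/ e).+1 < J * L + L by rewrite -mulSnr ltn_ceil.
have le_e : e * (n %/ e) <= n by rewrite mulnC leq_divM.
have egt0 : 0 < e by [].
(* Besides the reserve of about [n / e] vertices, less than one bottle is lost to rounding;
   [n >= e (L + 2)] bounds both by [2 n / e]. *)
have le_en : e * n <= e * (J * L) + 2 * n.
  have le1 : n <= J * L + L + (n %/ e).+1 by rewrite addnC -leq_subLR ltnW.
  have : e * n <= e * (J * L + L + (n %/ e).+1) by rewrite leq_mul2l le1 orbT.
  have : e * (L + 2) <= n by apply: leq_trans le_n; rewrite leq_addl.
  rewrite !mulnDr mulnS; move: le_e.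
  by move: (e * (n %/ e)) (e * n) (e * (J * L)) (e * L) => y1 y2 y3 y4; clear; lia.
have e2 : 1 < e.
  rewrite -(ltr_nat R) -(ltr_pM2r xi0); apply: lt_le_trans leE.
  by rewrite mul1r; lra.
have [|||X [P [_ tP _ leP _]]] := greedy n G _ _ J.
- by apply: leq_trans le_n; apply: leq_addr.
- move=> v; apply: (@le_trans _ _ (min_degree G)%:R%R); last first.
    by rewrite ler_nat min_degree_le.
  apply: le_trans deg; rewrite ler_pM2r //.
  pose c := chi_cr_star x H; pose r : R := (L0%:R / m%:R)%R.
  have mR : (0 < m%:R :> R)%R by rewrite ltr0n.
  have r1 : (1 <= r)%R.
    rewrite ler_pdivlMr // mul1r ler_nat /L0; apply: leq_trans (leq_addr _ _).
    by rewrite leq_pmull.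
  have rc : (r <= c + eta / 2)%R.
    have -> : c = inf E by [].
    by move: leB ltB; rewrite -/r; lra.
  have -> : ((Q * m)%:R / L%:R = r^-1 :> R)%R.
    rewrite LE !natrM /r; field.
    by rewrite !lt0r_neq0 ?ltr0n.
  have c1 : (1 <= c)%R by [].
  have c0 : (0 < c)%R by lra.
  have r0 : (0 < r)%R by lra.
  (* [1 / c - 1 / r = (r - c) / (c r)], where [r - c <= eta / 2] and [c r >= 1]. *)
  have : (c^-1 <= r^-1 + eta / 2)%R.
    rewrite -(ler_pM2r (mulr_gt0 c0 r0)).
    have -> : (c^-1 * (c * r) = r)%R by field; rewrite lt0r_neq0.
    have -> : ((r^-1 + eta / 2) * (c * r) = c + eta / 2 * (c * r))%R by field; rewrite lt0r_neq0.
    have : (1 <= c * r)%R by nra.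
    by nra.
  by rewrite /tiling_density -/c div1r; lra.
- rewrite -/L; have := ltn_Pdiv e2 ngt0; move: leJ.
  by move: (n %/ e) (J * L) => y1 y2; clear; lia.
exists P => //; apply: le_trans leP.
have JLR : (e%:R * n%:R <= e%:R * (J%:R * L%:R) + 2 * n%:R :> R)%R.
  by rewrite -!natrM -natrD ler_nat.
have eR : (0 < e%:R :> R)%R by rewrite ltr0n.
rewrite -!mulrA ler_pM2l // -(ler_pM2l eR).
have h1 : ((1 + xi) * ((e%:R - 2) * n%:R) <= (1 + xi) * (e%:R * (J%:R * L%:R)))%R.
  by rewrite ler_pM2l; [lra|rewrite addr_gt0].
have h2 : (e%:R * n%:R <= (1 + xi) * (e%:R - 2) * n%:R)%R.
  by rewrite ler_wpM2r ?ler0n //; lra.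
have -> : (e%:R * ((1 + xi) * (L%:R * J%:R)) = (1 + xi) * (e%:R * (J%:R * L%:R)) :> R)%R by ring.
by apply: le_trans h1; rewrite mulrA.
Qed.
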